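(* Consider the problem $\min_{x,z} F(x)+\phi(z)$ subject to $A(x)+Qz=0$, where $A$ is a multi-affine quadratic operator with coefficients $C_i,d_i,e_i$ ($i=1,\dots,n_c$). Suppose that $F$ is subanalytic and $F(x)=f(x)+\sum_{i=1}^n I_i(x_i)$, where $f$ is $C^2$ and $\mu_f$-strongly convex and each $I_i$ is the indicator function of a nonempty polyhedral set $X_i\subseteq\mathbb{R}^{n_i}$; that $\phi$ is $C^2$, $\mu_\phi$-strongly convex and $L_\phi$-smooth; that $Q\in\mathbb{R}^{n_c\times n_z}$ has full row rank; and that $$\rho\ \ge\ \max\Big\{\frac{4L_\phi^2}{\mu_\phi\,\lambda_{\min}^+(Q^TQ)},\ \frac{4L_\phi^2}{\mu_\phi\sqrt{\lambda_{\min}^+(QQ^T)}}\Big\}.$$ Then there exist constants $m_1,m_2,m_3>0$, depending only on the parameters of the problem and algorithm other than the matrices $C_i$ (such as $f$, $\mu_f,L_\phi,\mu_\phi,n_c$, the $d_i$, the $e_i$, the minimizers of $f$ and $\phi$, and the initialization), such that the following holds. Write $\|C\|:=\max_i\|C_i\|$ and let $(x^k,z^k,w^k)$ be the iterates of ADMM with penalty parameter $\rho$. If $$\|C\|\le\|(QQ^T)^{-1}Q\|^{-1}\min\Big\{m_1,\ m_2\,(\lambda_{\min}(QQ^T))^{\frac12},\ m_3\,(\lambda_{\min}(QQ^T))^{\frac14}\|(QQ^T)^{-1}Q\|^{\frac12}\Big\},$$ then there exist constants $c_2>1$ and $r>0$ such that $$L(x^k,z^k,w^k)-\min_{(x,z)\in\mathcal{B}(x^k,z^k;r)}L(x,z,w^k)\in\mathcal{O}(c_2^{-k}).$$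 Furthermore, $\lim_{k\to\infty}(x^k,z^k)=(x^\star,z^\star)$ is a local minimum of the problem $\min_{x,z}F(x)+\phi(z)$ subject to $A(x)+Qz=0$.
   Context: Variables: $x=(x_1,\dots,x_n)\in\mathbb{R}^{n_x}$ is partitioned into $n$ blocks $x_i\in\mathbb{R}^{n_i}$; $x_{-i}$ denotes all blocks except the $i$-th, and $x_{i:j}=(x_i,\dots,x_j)$ if $j\ge i$ (empty if $j<i$). $z\in\mathbb{R}^{n_z}$, $w\in\mathbb{R}^{n_c}$. Multi-affine quadratic operator: $A:\mathbb{R}^{n_x}\to\mathbb{R}^{n_c}$ such that for each $i\in\{1,\dots,n_c\}$ there are $C_i\in\mathbb{R}^{n_x\times n_x}$, $d_i\in\mathbb{R}^{n_x}$, $e_i\in\mathbb{R}$ with $(A(x))_i=\frac12x^TC_ix+d_i^Tx+e_i$, and moreover for every block index $j$ and every fixed $x_{-j}$, the map $x_j\mapsto A(x_j;x_{-j})$ is affine. A polyhedral set is a finite intersection of closed half-spaces. The indicator of a set takes value $0$ on the set and $+\infty$ outside. A function $g$ is $L$-smooth if $\|\nabla g(x)-\nabla g(x')\|\le L\|x-x'\|$ for all $x,x'$. A function is subanalytic if its graph is a subanalytic set. $\|M\|$ is the spectral norm of a matrix $M$; $\lambda_{\min}(M)$ and $\lambda_{\min}^+(M)$ are its smallest and smallest positive eigenvalues. $\mathcal{B}(p;r)$ is the ball with center $p$ and radius $r$. Augmented Lagrangian with parameter $\rho>0$: $L(x,z,w)=F(x)+\phi(z)+\langle w,A(x)+Qz\rangle+\frac{\rho}{2}\|A(x)+Qz\|^2$.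 ADMM: given an initial point $(x^0,z^0,w^0)$ and $\rho$, for $k=0,1,2,\dots$: for $i=1,\dots,n$ in order, $x_i^{k+1}\in\arg\min_{x_i}L(x_{1:i-1}^{k+1},x_i,x_{i+1:n}^k,z^k,w^k)$; then $z^{k+1}\in\arg\min_zL(x^{k+1},z,w^k)$; then $w^{k+1}=w^k+\rho(A(x^{k+1})+Qz^{k+1})$. *)

(* Defs.v *)
From HB Require Import structures.
From mathcomp Require Import all_boot all_order all_algebra.
From mathcomp Require Import all_classical all_reals all_analysis.

Set Implicit Arguments.
Unset Strict Implicit.
Unset Printing Implicit Defensive.

Import Order.TTheory GRing.Theory Num.Theory.
Import numFieldNormedType.Exports.

Local Open Scope classical_set_scope.
Local Open Scope ring_scope.

(* The library norm on matrices is the sup norm; the norms needed here are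
   Euclidean (on vectors) and spectral (on matrices).  Both vector norms induce
   the same topology, so library limits, derivatives and neighbourhoods are
   used unchanged. *)
Section Euclidean.
Variable R : realType.

Definition dotv p (u v : 'cV[R]_p) : R := \sum_i u i 0 * v i 0.

Definition enorm p (u : 'cV[R]_p) : R := Num.sqrt (dotv u u).

Definition spectral_norm p q (M : 'M[R]_(p, q)) : R :=
  sup [set enorm (M *m u) | u in [set u : 'cV[R]_q | enorm u <= 1]].

(* Applied to nonempty symmetric matrices, whose set of (real) eigenvalues is
   finite and nonempty, so that the infimum is a minimum; the same holds for
   the positive eigenvalues of a nonzero Gram matrix. *)
Definition lambda_min p (M : 'M[R]_p) : R := inf [set a | eigenvalue M a].

Definition lambda_min_pos p (M : 'M[R]_p) : R :=
  inf [set a | eigenvalue M a /\ 0 < a].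

End Euclidean.

Section Regularity.
Variable R : realType.

Definition C1 p (g : 'cV[R]_p -> R) : Prop :=
  (forall x, differentiable g x) /\
  (forall v, continuous (fun x => 'D_v g x)).

Definition C2 p (g : 'cV[R]_p -> R) : Prop :=
  C1 g /\ forall v, C1 (fun x => 'D_v g x).

Definition gradient p (g : 'cV[R]_p -> R) (x : 'cV[R]_p) : 'cV[R]_p :=
  \col_i 'D_(delta_mx i 0) g x.

Definition L_smooth p (L : R) (g : 'cV[R]_p -> R) : Prop :=
  (forall x, differentiable g x) /\
  (forall x y, enorm (gradient g x - gradient g y) <= L * enorm (x - y)).

Definition strongly_convex p (mu : R) (g : 'cV[R]_p -> R) : Prop :=
  0 < mu /\
  forall (x y : 'cV[R]_p) (t : R), 0 <= t <= 1 ->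
    g (t *: x + (1 - t) *: y) <=
      t * g x + (1 - t) * g y - mu / 2 * (t * (1 - t)) * enorm (x - y) ^+ 2.

Definition affine_map p q (g : 'cV[R]_p -> 'cV[R]_q) : Prop :=
  exists (M : 'M[R]_(q, p)) (b : 'cV[R]_q), forall y, g y = M *m y + b.

(* Finite intersection of closed half-spaces. *)
Definition polyhedral p (S : set 'cV[R]_p) : Prop :=
  exists (m : nat) (a : 'I_m -> 'cV[R]_p) (b : 'I_m -> R),
    (forall j, a j != 0) /\
    S = \bigcap_(j in [set: 'I_m]) [set y | dotv (a j) y <= b j].

End Regularity.

Section Subanalytic.
Variable R : realType.

(* c is a family of coefficients indexed by the multi-indices al in N^p.  The
   power series is summed over the boxes {al | al i < N for all i}; since it
   is required to converge absolutely, the order of summation is immaterial. *)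
Definition analytic_at p (g : 'cV[R]_p -> R) (a : 'cV[R]_p) : Prop :=
  exists (c : ('I_p -> nat) -> R) (r : R), 0 < r /\
  forall h : 'cV[R]_p, (forall i, `|h i 0| < r) ->
    cvgn (fun N => \sum_(al : {ffun 'I_p -> 'I_N})
                     `|c (fun i => al i : nat) * \prod_i h i 0 ^+ al i|) /\
    (fun N => \sum_(al : {ffun 'I_p -> 'I_N})
                c (fun i => al i : nat) * \prod_i h i 0 ^+ al i) @ \oo --> g (a + h).

(* The functions u i j, v i j are total, but only required to be analytic
   on V. *)
Definition semianalytic p (S : set 'cV[R]_p) : Prop :=
  forall a : 'cV[R]_p, exists V : set 'cV[R]_p,
    [/\ open V, V a &
     exists (m q : nat) (u v : 'I_m -> 'I_q -> 'cV[R]_p -> R),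
       (forall i j x, V x -> analytic_at (u i j) x /\ analytic_at (v i j) x) /\
       S `&` V =
         [set x | V x /\ exists i, forall j, u i j x = 0 /\ 0 < v i j x]].

(* Locally the projection of a bounded semianalytic set. *)
Definition subanalytic p (S : set 'cV[R]_p) : Prop :=
  forall a : 'cV[R]_p, exists V : set 'cV[R]_p,
    [/\ open V, V a &
     exists (m : nat) (B : set 'cV[R]_(p + m)),
       [/\ semianalytic B, bounded_set B &
        S `&` V = [set x | exists y : 'cV[R]_m, B (col_mx x y)]]].

(* The graph of an extended-real-valued function consists of the points
   (x, g x) with g x finite. *)
Definition graph p (g : 'cV[R]_p -> \bar R) : set 'cV[R]_(p + 1) :=
  [set u | g (usubmx u) = (dsubmx u 0 0)%:E].

Definition subanalytic_fun p (g : 'cV[R]_p -> \bar R) : Prop :=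
  subanalytic (graph g).

End Subanalytic.

Section Optimization.
Variables (R : realType) (T : Type).
Implicit Types (g : T -> \bar R) (S : set T).
Local Open Scope ereal_scope.

(* A minimizer must have a value < +oo: a function that is identically +oo
   has no minimizer.  Otherwise, from an initial point with some block outside
   its constraint set, every infeasible point would be an admissible ADMM
   update. *)
Definition argmin g : set T := [set t | g t < +oo /\ forall s, g t <= g s].

Definition is_min S g (v : \bar R) : Prop :=
  (exists2 t, S t & g t = v) /\ forall t, S t -> v <= g t.

Definition indicator S (t : T) : \bar R := if `[< S t >] then 0 else +oo.

End Optimization.

Definition is_local_min (R : realType) (T : topologicalType)
    (S : set T) (g : T -> \bar R) (p : T) : Prop :=
  [/\ S p, (g p < +oo)%E & \forall q \near p, S q -> (g p <= g q)%E].

Section Problem.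
Variables (R : realType) (n : nat) (dim : 'I_n -> nat) (nz nc : nat).
Local Notation nx := (\sum_(i < n) dim i)%N.

(* The vector x with its j-th block replaced by y. *)
Definition set_block (x : 'cV[R]_nx) (j : 'I_n) (y : 'cV[R]_(dim j)) :
    'cV[R]_nx :=
  \mxcol_i dfwith (submxcol x) j y i.
Arguments set_block : clear implicits.

Definition quad_op (C : 'I_nc -> 'M[R]_nx) (d : 'I_nc -> 'cV[R]_nx)
    (e : 'I_nc -> R) (x : 'cV[R]_nx) : 'cV[R]_nc :=
  \col_i (2^-1 * dotv x (C i *m x) + dotv (d i) x + e i).

Definition multi_affine (A : 'cV[R]_nx -> 'cV[R]_nc) : Prop :=
  forall (j : 'I_n) (x : 'cV[R]_nx), affine_map (fun y => A (set_block x j y)).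

Definition objF (f : 'cV[R]_nx -> R) (X : forall i, set 'cV[R]_(dim i))
    (x : 'cV[R]_nx) : \bar R :=
  ((f x)%:E + \sum_(i < n) indicator R (X i) (submxcol x i))%E.

Definition lagrangian (F : 'cV[R]_nx -> \bar R) (phi : 'cV[R]_nz -> R)
    (A : 'cV[R]_nx -> 'cV[R]_nc) (Q : 'M[R]_(nc, nz)) (rho : R)
    (x : 'cV[R]_nx) (z : 'cV[R]_nz) (w : 'cV[R]_nc) : \bar R :=
  (F x + (phi z + dotv w (A x + Q *m z)
          + rho / 2 * enorm (A x + Q *m z) ^+ 2)%:E)%E.

(* (x'_{1:i-1}, x_{i:n}): the first blocks are already updated. *)
Definition partial_update (x' x : 'cV[R]_nx) (i : 'I_n) : 'cV[R]_nx :=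
  \mxcol_j (if (j < i)%N then submxcol x' j else submxcol x j).

Definition ADMM_iterates
    (L : 'cV[R]_nx -> 'cV[R]_nz -> 'cV[R]_nc -> \bar R)
    (A : 'cV[R]_nx -> 'cV[R]_nc) (Q : 'M[R]_(nc, nz)) (rho : R)
    (x0 : 'cV[R]_nx) (z0 : 'cV[R]_nz) (w0 : 'cV[R]_nc)
    (x : nat -> 'cV[R]_nx) (z : nat -> 'cV[R]_nz) (w : nat -> 'cV[R]_nc) :
    Prop :=
  [/\ x 0%N = x0, z 0%N = z0, w 0%N = w0 &
   forall k : nat,
   [/\ forall i : 'I_n,
         argmin (fun y : 'cV[R]_(dim i) =>
                   L (set_block (partial_update (x k.+1) (x k) i) i y)
                     (z k) (w k))
                (submxcol (x k.+1) i),
       argmin (fun y => L (x k.+1) y (w k)) (z k.+1) &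
       w k.+1 = w k + rho *: (A (x k.+1) + Q *m z k.+1)]].

(* Closed Euclidean ball of R^(nx) x R^(nz). *)
Definition eball (p : 'cV[R]_nx * 'cV[R]_nz) (r : R) :
    set ('cV[R]_nx * 'cV[R]_nz) :=
  [set q | Num.sqrt (enorm (q.1 - p.1) ^+ 2 + enorm (q.2 - p.2) ^+ 2) <= r].

End Problem.

Arguments set_block {R n dim} x j y.

(* Main.v *)
(** Let [x_k, z_k, w_k] be the iterates and write [p_k := (x_k, z_k)] and
    [d_k := |p_{k+1} - p_k|].  The constants may depend on everything but the
    matrices [C_i], so it is enough to treat [C] of small enough norm, and the
    argument is then a perturbation of the convex case.

    - Descent: each block of the objective is strongly convex, the optimality
      of the [z]-step gives [gradient phi z_k = - Q^T w_k], hence the dual step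
      costs at most [mu_phi / 4 |z_{k+1} - z_k|^2] by the bound on [rho], and
      the Lagrangian values [L_k] satisfy [L_{k+1} + c d_k^2 <= L_k].
    - Bounds: for [|C| <= 1] the values [L_k] have an upper bound independent
      of [C], and [L_k >= F x_k + phi (z_k - g) + rho / 4 |r_k|^2] with
      [Q g = r_k := A x_k + Q z_k]; so the iterates stay in a ball that does
      not depend on [C].
    - Key inequality: [x -> <w_k + rho r_k, A x>] has curvature at most
      [const * |C|] on that ball, which [mu_f] absorbs.  As the iterates
      satisfy the first-order conditions up to [O(d_k)], for all feasible [y]
      and all [v],
      [L_{k+1} - K d_k^2 + c |(y, v) - p_{k+1}|^2 <= L(y, v, w_{k+1})].

    Applied to pairs of iterates, the key inequality makes [p_k] a Cauchy
    sequence; applied to its limit [p*] it gives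
    [L_{k+1} - L* <= K d_k^2 <= K' (L_k - L_{k+1})], hence a geometric rate for
    [L_k - L*] and [d_k^2]; applied to a minimizer over the ball around
    [p_{k+1}] it gives the rate of the theorem; and applied to the points of
    the constraint set it shows that [p*] is a minimizer. *)

Require Import Defs.
From HB Require Import structures.
From mathcomp Require Import all_boot all_order all_algebra.
From mathcomp Require Import all_classical all_reals all_analysis.
From mathcomp Require Import ring lra.

Import Order.TTheory GRing.Theory Num.Theory.
Import numFieldNormedType.Exports.

Local Open Scope classical_set_scope.
Local Open Scope ring_scope.

Set Implicit Arguments.
Unset Strict Implicit.
Unset Printing Implicit Defensive.

(** * Euclidean norm *)

Section EuclideanTheory.
Variable R : realType.

Lemma dotvE p (u v : 'cV[R]_p) : dotv u v = (u^T *m v) 0 0.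
Proof. by rewrite mxE; apply: eq_bigr => i _; rewrite mxE. Qed.

Lemma dotvC p (u v : 'cV[R]_p) : dotv u v = dotv v u.
Proof. by apply: eq_bigr => i _; rewrite mulrC. Qed.

Lemma dotvDr p (u v w : 'cV[R]_p) : dotv u (v + w) = dotv u v + dotv u w.
Proof. by rewrite !dotvE mulmxDr mxE. Qed.

Lemma dotvDl p (u v w : 'cV[R]_p) : dotv (v + w) u = dotv v u + dotv w u.
Proof. by rewrite dotvC dotvDr !(dotvC u). Qed.

Lemma dotvZr p a (u v : 'cV[R]_p) : dotv u (a *: v) = a * dotv u v.
Proof. by rewrite !dotvE -scalemxAr mxE. Qed.

Lemma dotvZl p a (u v : 'cV[R]_p) : dotv (a *: u) v = a * dotv u v.
Proof. by rewrite dotvC dotvZr dotvC. Qed.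

Lemma dotvNr p (u v : 'cV[R]_p) : dotv u (- v) = - dotv u v.
Proof. by rewrite -scaleN1r dotvZr mulN1r. Qed.

Lemma dotvNl p (u v : 'cV[R]_p) : dotv (- u) v = - dotv u v.
Proof. by rewrite dotvC dotvNr dotvC. Qed.

Lemma dotvBr p (u v w : 'cV[R]_p) : dotv u (v - w) = dotv u v - dotv u w.
Proof. by rewrite dotvDr dotvNr. Qed.

Lemma dotvBl p (u v w : 'cV[R]_p) : dotv (v - w) u = dotv v u - dotv w u.
Proof. by rewrite dotvDl dotvNl. Qed.

Lemma dotv0r p (u : 'cV[R]_p) : dotv u 0 = 0.
Proof. by rewrite -(scale0r 0) dotvZr mul0r. Qed.

Lemma dotv0l p (u : 'cV[R]_p) : dotv 0 u = 0.
Proof. by rewrite dotvC dotv0r. Qed.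

Definition dotv_lin := (dotvDl, dotvDr, dotvBl, dotvBr, dotvNl, dotvNr,
  dotvZl, dotvZr, dotv0l, dotv0r).

Lemma dotv_sumr p (I : Type) (s : seq I) (P : pred I) (F : I -> 'cV[R]_p) u :
  dotv u (\sum_(i <- s | P i) F i) = \sum_(i <- s | P i) dotv u (F i).
Proof.
by elim/big_rec2: _ => [|i y x _ <-]; rewrite ?dotv0r ?dotvDr.
Qed.

Lemma dotv_mulmxr p q (M : 'M[R]_(p, q)) u v :
  dotv u (M *m v) = dotv (M^T *m u) v.
Proof. by rewrite !dotvE trmx_mul trmxK mulmxA. Qed.

Lemma dotv_mulmxl p q (M : 'M[R]_(p, q)) u v :
  dotv (M *m u) v = dotv u (M^T *m v).
Proof. by rewrite dotv_mulmxr trmxK. Qed.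

Lemma dotv_ge0 p (u : 'cV[R]_p) : 0 <= dotv u u.
Proof. by apply: sumr_ge0 => i _; rewrite -expr2 sqr_ge0. Qed.

Lemma dotv_eq0 p (u : 'cV[R]_p) : (dotv u u == 0) = (u == 0).
Proof.
apply/eqP/eqP => [|->]; last exact: dotv0r.
move/eqP; rewrite psumr_eq0 => [/allP u0|i _]; last by rewrite -expr2 sqr_ge0.
apply/colP => i; have := u0 i (mem_index_enum _).
by rewrite mxE -expr2 sqrf_eq0 => /eqP.
Qed.

Lemma dotv_delta p (u : 'cV[R]_p) i : dotv u (delta_mx i 0) = u i 0.
Proof.
rewrite /dotv (bigD1 i)//= big1 => [|j ji]; rewrite mxE ?eqxx.
  by rewrite mulr1 addr0.
by rewrite (negbTE ji) mulr0.
Qed.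

Lemma enorm_ge0 p (u : 'cV[R]_p) : 0 <= enorm u.
Proof. exact: sqrtr_ge0. Qed.

Lemma enorm_sqr p (u : 'cV[R]_p) : enorm u ^+ 2 = dotv u u.
Proof. by rewrite sqr_sqrtr// dotv_ge0. Qed.

Lemma enorm_eq0 p (u : 'cV[R]_p) : (enorm u == 0) = (u == 0).
Proof. by rewrite -dotv_eq0 -enorm_sqr sqrf_eq0. Qed.

Lemma enorm0 p : enorm (0 : 'cV[R]_p) = 0.
Proof. by apply/eqP; rewrite enorm_eq0. Qed.

Lemma enormZ p a (u : 'cV[R]_p) : enorm (a *: u) = `|a| * enorm u.
Proof.
by rewrite /enorm !dotv_lin mulrA -expr2 sqrtrM ?sqr_ge0// sqrtr_sqr.
Qed.

Lemma enormN p (u : 'cV[R]_p) : enorm (- u) = enorm u.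
Proof. by rewrite -scaleN1r enormZ normrN1 mul1r. Qed.

Lemma enormC p (u v : 'cV[R]_p) : enorm (u - v) = enorm (v - u).
Proof. by rewrite -enormN opprB. Qed.

(** The squared norm of [dotv v v *: u - dotv u v *: v] is [c * (a * c - b ^+ 2)], and [c] is
    positive unless [v = 0]. *)
Lemma cauchy_schwarz p (u v : 'cV[R]_p) : `|dotv u v| <= enorm u * enorm v.
Proof.
rewrite -(@ler_pXn2r _ 2) ?nnegrE ?mulr_ge0 ?enorm_ge0//.
rewrite exprMn !enorm_sqr -normrX ger0_norm ?sqr_ge0//.
have [->|v0] := eqVneq v 0; first by rewrite !dotv0r expr0n mulr0.
have vv : 0 < dotv v v by rewrite lt_neqAle eq_sym dotv_eq0 v0 dotv_ge0.
have := dotv_ge0 (dotv v v *: u - dotv u v *: v).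
rewrite !dotv_lin (dotvC v u).
set a := dotv u u; set b := dotv u v; set c := dotv v v => h.
have {}h : 0 <= c * (a * c - b ^+ 2) by lra.
by rewrite pmulr_rge0// subr_ge0 in h.
Qed.

Lemma dotv_le p (u v : 'cV[R]_p) : dotv u v <= enorm u * enorm v.
Proof. exact: le_trans (ler_norm _) (cauchy_schwarz _ _). Qed.

Lemma dotv_geN p (u v : 'cV[R]_p) : - (enorm u * enorm v) <= dotv u v.
Proof. by have := cauchy_schwarz u v; rewrite ler_norml => /andP[]. Qed.

Lemma ler_enormD p (u v : 'cV[R]_p) : enorm (u + v) <= enorm u + enorm v.
Proof.
rewrite -(@ler_pXn2r _ 2) ?nnegrE ?addr_ge0 ?enorm_ge0//.
rewrite sqrrD !enorm_sqr !dotv_lin (dotvC v u).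
by have := dotv_le u v; lra.
Qed.

Lemma ler_enormB p (u v : 'cV[R]_p) : enorm (u - v) <= enorm u + enorm v.
Proof. by rewrite -(enormN v) ler_enormD. Qed.

Lemma ler_enorm_sum p (I : Type) (s : seq I) (P : pred I) (F : I -> 'cV[R]_p) :
  enorm (\sum_(i <- s | P i) F i) <= \sum_(i <- s | P i) enorm (F i).
Proof.
elim/big_rec2: _ => [|i y x _ h]; first by rewrite enorm0.
exact: le_trans (ler_enormD _ _) (lerD _ h).
Qed.

Lemma enormD_sqr p (u v : 'cV[R]_p) :
  enorm (u + v) ^+ 2 = enorm u ^+ 2 + 2 * dotv u v + enorm v ^+ 2.
Proof. by rewrite !enorm_sqr !dotv_lin (dotvC v u); ring. Qed.

Lemma le_enorm_coord p (u : 'cV[R]_p) i : `|u i 0| <= enorm u.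
Proof.
rewrite -(@ler_pXn2r _ 2) ?nnegrE ?enorm_ge0// enorm_sqr real_normK ?num_real//.
rewrite /dotv (bigD1 i)//= expr2 lerDl.
by apply: sumr_ge0 => j _; rewrite -expr2 sqr_ge0.
Qed.

Lemma enorm_delta p (i : 'I_p) : enorm (delta_mx i 0 : 'cV[R]_p) = 1.
Proof. by rewrite /enorm dotv_delta mxE !eqxx sqrtr1. Qed.

Lemma col_sum_delta p (u : 'cV[R]_p) : u = \sum_i u i 0 *: delta_mx i 0.
Proof.
apply/colP => i; rewrite summxE (bigD1 i)//= !mxE !eqxx mulr1 big1 ?addr0//.
by move=> j ji; rewrite !mxE eq_sym (negbTE ji) mulr0.
Qed.

Lemma enorm_le_sum p (v : 'cV[R]_p) : enorm v <= \sum_i `|v i 0|.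
Proof.
rewrite {1}[v]col_sum_delta; apply: le_trans (ler_enorm_sum _ _ _) _.
by apply: ler_sum => i _; rewrite enormZ enorm_delta mulr1.
Qed.

Lemma norm_le_enorm p (u : 'cV[R]_p) : `|u| <= enorm u.
Proof.
rewrite {1}/Num.norm/= mx_normrE; apply/bigmax_leP.
by split=> [|[i j] _]; rewrite ?enorm_ge0//= ord1 le_enorm_coord.
Qed.

Lemma enorm_le_norm p (u : 'cV[R]_p) : enorm u <= p%:R * `|u|.
Proof.
apply: le_trans (enorm_le_sum _) _.
rewrite [leRHS](_ : _ = \sum_(i < p) `|u|); last first.
  by rewrite sumr_const card_ord mulr_natl.
apply: ler_sum => i _; rewrite [leRHS]/Num.norm/= mx_normrE.
by apply/bigmax_geP; right; exists (i, 0).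
Qed.

(** A crude bound by Cauchy-Schwarz on each row. It makes the set in the definition of the spectral
    norm bounded, so that its [sup] is an upper bound. *)
Lemma mulmx_bounded p q (M : 'M[R]_(p, q)) :
  exists2 K : R, 0 <= K & forall u, enorm (M *m u) <= K * enorm u.
Proof.
exists (\sum_i enorm (row i M)^T).
  by apply: sumr_ge0 => i _; rewrite enorm_ge0.
move=> u; rewrite mulr_suml.
apply: le_trans (enorm_le_sum _) _; apply: ler_sum => i _.
rewrite (_ : (M *m u) i 0 = dotv (row i M)^T u); first exact: cauchy_schwarz.
by rewrite mxE; apply: eq_bigr => k _; rewrite !mxE.
Qed.

Lemma spectral_norm_has_ub p q (M : 'M[R]_(p, q)) :
  has_ubound [set enorm (M *m u) | u in [set u : 'cV[R]_q | enorm u <= 1]].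
Proof.
have [K K0 hK] := mulmx_bounded M; exists K => _ [u /= u1 <-].
by apply: le_trans (hK u) _; rewrite ler_piMr.
Qed.

Lemma spectral_norm_ge0 p q (M : 'M[R]_(p, q)) : 0 <= spectral_norm M.
Proof.
apply: (ub_le_sup (spectral_norm_has_ub M)).
by exists 0 => /=; rewrite ?mulmx0 ?enorm0// ler01.
Qed.

Lemma enorm_mulmx_le p q (M : 'M[R]_(p, q)) u :
  enorm (M *m u) <= spectral_norm M * enorm u.
Proof.
have [->|u0] := eqVneq u 0; first by rewrite mulmx0 !enorm0 mulr0.
have nu : 0 < enorm u by rewrite lt_neqAle eq_sym enorm_eq0 u0 enorm_ge0.
rewrite -ler_pdivrMr//; apply: (ub_le_sup (spectral_norm_has_ub M)).
exists ((enorm u)^-1 *: u) => /=.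
  by rewrite enormZ gtr0_norm ?invr_gt0// mulVf// gt_eqF.
by rewrite -scalemxAr enormZ gtr0_norm ?invr_gt0// mulrC.
Qed.

Lemma quad_form_le p (M : 'M[R]_p) e u v : spectral_norm M <= e ->
  `|dotv u (M *m v)| <= e * (enorm u * enorm v).
Proof.
move=> Me; apply: le_trans (cauchy_schwarz _ _) _.
rewrite mulrCA ler_wpM2l ?enorm_ge0//.
by apply: le_trans (enorm_mulmx_le _ _) _; rewrite ler_wpM2r ?enorm_ge0.
Qed.

End EuclideanTheory.

(** * Topology and gradients *)

Section Topology.
Variable R : realType.

Lemma cvg_enorm p (u : nat -> 'cV[R]_p) l :
  (forall e, 0 < e -> exists N, forall k, (N <= k)%N -> enorm (u k - l) <= e) <->
  u @ \oo --> l.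
Proof.
split=> [ul|/cvgrPdistC_le ul e e0].
  apply/cvgrPdistC_le => e e0; have [N hN] := ul e e0.
  exists N => // k /= Nk; exact: le_trans (norm_le_enorm _) (hN k Nk).
(* The divisor [p.+1] instead of [p] covers dimension 0. *)
have e1 : 0 < e / p.+1%:R by rewrite divr_gt0.
have [N _ hN] := ul _ e1; exists N => k Nk.
apply: le_trans (enorm_le_norm _) _.
apply: le_trans (ler_wpM2l _ (hN k Nk)) _ => //.
rewrite mulrCA ler_piMr ?(ltW e0)// ler_pdivrMr// mul1r ler_nat//.
Qed.

Lemma cauchy_enorm p (u : nat -> 'cV[R]_p) :
  (forall e, 0 < e -> exists N, forall k l, (N <= k)%N -> (N <= l)%N ->
     enorm (u k - u l) <= e) ->
  exists l, forall e, 0 < e ->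
    exists N, forall k, (N <= k)%N -> enorm (u k - l) <= e.
Proof.
move=> uC; suff : cvgn u.
  by move=> /cvg_ex[l /cvg_enorm ul]; exists l.
apply/cauchy_cvgP/cauchy_exP => e e0.
have e2 : 0 < e / 2 by rewrite divr_gt0.
have [N hN] := uC _ e2; exists (u N), N => // k /= Nk.
rewrite -ball_normE /ball_/=.
apply: le_lt_trans (norm_le_enorm _) _; apply: le_lt_trans (hN _ _ _ _) _ => //.
by rewrite ltr_pdivrMr// ltr_pMr// ltr1n.
Qed.

Lemma continuous_coord p (i : 'I_p) : continuous (fun x : 'cV[R]_p => x i 0).
Proof. exact: coord_continuous. Qed.

Lemma continuous_sumr (T : topologicalType) (I : finType) (F : I -> T -> R) :
  (forall i, continuous (F i)) -> continuous (fun t => \sum_i F i t).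
Proof. by move=> cF t; apply: (cvg_big add_continuous) => i _; exact: cF. Qed.

Lemma continuous_addr (T : topologicalType) (f g : T -> R) :
  continuous f -> continuous g -> continuous (fun t => f t + g t).
Proof. by move=> cf cg t; exact: (continuousD (cf t) (cg t)). Qed.

Lemma continuous_mulr (T : topologicalType) (f g : T -> R) :
  continuous f -> continuous g -> continuous (fun t => f t * g t).
Proof. by move=> cf cg t; exact: (continuousM (cf t) (cg t)). Qed.

Lemma continuous_dotv p (a : 'cV[R]_p) : continuous (dotv a).
Proof.
apply: continuous_sumr => i; apply: continuous_mulr; first exact: cst_continuous.
exact: continuous_coord.
Qed.

Lemma continuous_quad p (M : 'M[R]_p) : continuous (fun x => dotv x (M *m x)).
Proof.
apply: continuous_sumr => i; apply: continuous_mulr; first exact: continuous_coord.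
under eq_fun do rewrite mxE.
apply: continuous_sumr => j; apply: continuous_mulr; first exact: cst_continuous.
exact: continuous_coord.
Qed.

Lemma continuous_enorm p : continuous (@enorm R p).
Proof.
move=> x; apply: continuous_comp; last exact: sqrt_continuous.
by apply: continuous_sumr => i; apply: continuous_mulr; exact: continuous_coord.
Qed.

Lemma continuous_enormB p (a : 'cV[R]_p) :
  continuous (fun x : 'cV[R]_p => enorm (x - a)).
Proof.
move=> x; apply: (@continuous_comp _ _ _ (fun x : 'cV[R]_p => x - a) (@enorm R p)).
  move=> S /nbhs_ballP[e /= e0 hS]; apply/nbhs_ballP; exists e => // y.
  rewrite -ball_normE /ball_/= => xy; apply: hS.
  by rewrite -ball_normE /ball_/= opprB addrA subrK.
exact: continuous_enorm.
Qed.

Lemma continuous_trmx p q : continuous (fun M : 'M[R]_(p, q) => M^T).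
Proof.
move=> M A /nbhs_ballP[e /= e0 hA]; apply/nbhs_ballP; exists e => // N [_ h].
by apply: hA; split=> // i j; rewrite !mxE; exact: h.
Qed.

(** Heine-Borel for row vectors, transported to columns by the continuous transpose. *)
Lemma compact_enorm p (B : R) : compact [set x : 'cV[R]_p | enorm x <= B].
Proof.
have c1 : compact [set y : 'rV[R]_p | enorm y^T <= B].
  have cT : continuous (fun y : 'rV[R]_p => enorm y^T).
    by move=> y; apply: continuous_comp; [exact: continuous_trmx|exact: continuous_enorm].
  apply: bounded_closed_compact.
    exists B; split; first exact: num_real.
    move=> M BM y /= yB; apply: le_trans (le_trans yB (ltW BM)).
    rewrite {1}/Num.norm/= mx_normrE; apply/bigmax_leP.
    split=> [|[i j] _]; rewrite ?enorm_ge0//= ord1.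
    by have := le_enorm_coord y^T j; rewrite mxE.
  apply: (@preimage_closed _ _ (fun y : 'rV[R]_p => enorm y^T) [set r | r <= B]).
    by move=> y _; exact: cT.
  exact: closed_le.
rewrite (_ : mkset _ = [set y^T | y in [set y : 'rV[R]_p | enorm y^T <= B]]).
  apply: continuous_compact => //; apply: continuous_subspaceT.
  exact: continuous_trmx.
apply/seteqP; split=> x /=; last by case=> y ? <-.
by exists x^T; rewrite /= ?trmxK.
Qed.

Lemma bounded_on_ball p (g : 'cV[R]_p -> R) (B : R) : continuous g ->
  exists2 K : R, 0 <= K & forall x, enorm x <= B -> `|g x| <= K.
Proof.
move=> cg; have [B0|B0] := ltP B 0.
  by exists 0 => // x; rewrite leNgt (lt_le_trans B0)// enorm_ge0.
have [|||c _ hc] := @compact_EVT_max _ _ (fun x => `|g x|)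
    [set x : 'cV[R]_p | enorm x <= B].
- by exists 0; rewrite /= enorm0.
- exact: compact_enorm.
- apply: continuous_subspaceT => x.
  exact: (continuous_comp (cg x) (@norm_continuous _ R^o _)).
exists `|g c| => // x xB; apply: hc; exact/mem_set.
Qed.

Lemma compact_pair_min p q (g : 'cV[R]_p * 'cV[R]_q -> R)
    (S : set ('cV[R]_p * 'cV[R]_q)) (B : R) :
  continuous g -> closed S -> S !=set0 ->
  (forall t, S t -> enorm t.1 <= B /\ enorm t.2 <= B) ->
  exists2 c, S c & forall t, S t -> g c <= g t.
Proof.
move=> cg cS S0 SB.
have cp := compact_setX (@compact_enorm p B) (@compact_enorm q B).
have cSS : compact S.
  by apply: subclosed_compact cp _ => // t /SB [].
have [c /set_mem cS' hc] := compact_EVT_min S0 cSS (continuous_subspaceT cg).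
by exists c => // t St; apply: hc; exact/mem_set.
Qed.

End Topology.

(** * Gradients of strongly convex and of smooth functions *)

Section Gradient.
Variable R : realType.

Lemma derive_gradient p (g : 'cV[R]_p -> R) x v : differentiable g x ->
  'D_v g x = dotv (gradient g x) v.
Proof.
move=> dg; rewrite deriveE//.
rewrite {1}[v]col_sum_delta.
rewrite linear_sum; apply: eq_bigr => i _.
by rewrite linearZ /= mxE deriveE// mulrC.
Qed.

(** Strong convexity on the segment bounds the difference quotient at [t] by
    [g y - g x - mu / 2 * (1 - t) * E]; then [t] tends to 0. *)
Lemma strongly_convex_gradient p (g : 'cV[R]_p -> R) mu x y :
  strongly_convex mu g -> differentiable g x ->
  g x + dotv (gradient g x) (y - x) + mu / 2 * enorm (y - x) ^+ 2 <= g y.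
Proof.
move=> [mu0 cg] dg; rewrite -derive_gradient//.
have : derivable g x (y - x) by exact: diff_derivable.
set D := 'D_(y - x) g x; set E := enorm (y - x) ^+ 2 => dgx.
suff : D <= g y - g x - mu / 2 * E by lra.
rewrite leNgt; apply/negP => hD.
set c := D - (g y - g x - mu / 2 * E).
have c0 : 0 < c by rewrite /c subr_gt0.
have /cvgrPdist_lt/(_ (c / 2)) : (fun h => h^-1 *: (g (h *: (y - x) + x) - g x)) @ 0^' --> D.
  exact: dgx.
have c2 : 0 < c / 2 by rewrite divr_gt0.
move=> /(_ c2); rewrite near_withinE => /nbhs_ballP[d /= d0 hd].
have E0 : 0 <= E by rewrite sqr_ge0.
(* Below [d] the quotient is within [c / 2] of [D]; the last bound keeps the error [t * mu * E]
   below [c / 2], where [E + 1] avoids a zero divisor. *)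
pose t := Num.min (d / 2) (Num.min 1 (c / (2 * (mu * (E + 1))))).
have t0 : 0 < t.
  rewrite !lt_min ltr01 !divr_gt0//= mulr_gt0// mulr_gt0//.
  by rewrite ltr_wpDl.
have t1 : t <= 1 by rewrite /t !ge_min lexx !orbT.
have td : t < d.
  by rewrite /t gt_min ltr_pdivrMr// ltr_pMr// ltr1n.
have tc : t * (mu * (E + 1)) <= c / 2.
  rewrite -ler_pdivlMr; last by rewrite mulr_gt0// ltr_wpDl.
  by rewrite -mulrA -invfM /t !ge_min lexx !orbT.
have := hd t; rewrite -ball_normE /ball_/= sub0r normrN gtr0_norm//.
move=> /(_ td); rewrite gt_eqF// => /(_ isT).
rewrite -[_ *: (_ - _)]/(t^-1 * (g (t *: (y - x) + x) - g x)).
have := cg y x t; rewrite (ltW t0) t1 => /(_ isT).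
rewrite (_ : t *: y + (1 - t) *: x = t *: (y - x) + x); last first.
  by rewrite scalerBr scalerBl scale1r -addrA addrA -[RHS]addrA (addrC (- _)).
rewrite -/E; set G := g (_ + x) => hG.
rewrite ltr_norml => /andP[_].
have : t^-1 * (G - g x) <= g y - g x - mu / 2 * (1 - t) * E.
  by rewrite ler_pdivrMl//; nra.
have : t * mu * E <= c / 2.
  by apply: le_trans tc; rewrite -mulrA ler_pM2l// ler_pM2l// lerDl.
rewrite /c; nra.
Qed.

Lemma segment_derive p (g : 'cV[R]_p -> R) x y : (forall z, differentiable g z) ->
  exists2 t, 0 <= t <= 1 &
    g x - g y = dotv (gradient g (y + t *: (x - y))) (x - y).
Proof.
move=> dg; pose h (t : R) := g (y + t *: (x - y)).
have dh (t : R) : is_derive t (1 : R) h ('D_(x - y) g (y + t *: (x - y))).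
  have e : (fun s : R => s^-1 *: (h (s *: (1 : R) + t) - h t)) =
     (fun s => s^-1 *: (g (s *: (x - y) + (y + t *: (x - y))) - g (y + t *: (x - y)))).
    apply/funext => s; rewrite /h; congr (_ *: (g _ - _)).
    by rewrite scalerDl [s *: 1]mulr1 addrCA.
  apply: DeriveDef.
    by rewrite /derivable e; exact: diff_derivable.
  by rewrite /derive e.
have [|t /[!in_itv]/= t01 ht] := MVT ltr01 (fun t _ => dh t).
  apply: derivable_within_continuous => t _; by case: (dh t).
exists t; first by case/andP: t01 => /ltW -> /ltW ->.
rewrite -derive_gradient//.
by have := ht; rewrite /h scale0r addr0 scale1r subrKC subr0 mulr1.
Qed.

(** The partial derivatives are bounded on the ball by compactness, and the mean value point stays
    in the ball by convexity. *)
Lemma C1_lipschitz p (g : 'cV[R]_p -> R) (B : R) : C1 g ->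
  exists2 K : R, 0 <= K & forall x y, enorm x <= B -> enorm y <= B ->
    `|g x - g y| <= K * enorm (x - y).
Proof.
move=> [dg cg].
have /choice[K hK] : forall i : 'I_p, exists K : R, 0 <= K /\
    forall x, enorm x <= B -> `|'D_(delta_mx i 0) g x| <= K.
  by move=> i; have [K ? ?] := bounded_on_ball B (cg (delta_mx i 0)); exists K.
exists (\sum_i K i); first by apply: sumr_ge0 => i _; case: (hK i).
move=> x y xB yB; have [t /andP[t0 t1] ->] := segment_derive x y dg.
apply: le_trans (cauchy_schwarz _ _) _; apply: ler_wpM2r; first exact: enorm_ge0.
set z := y + _; have zB : enorm z <= B.
  rewrite (_ : z = t *: x + (1 - t) *: y); last first.
    by rewrite /z scalerBl scale1r scalerBr addrCA.
  apply: le_trans (ler_enormD _ _) _; rewrite !enormZ !ger0_norm ?subr_ge0//.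
  by nra.
apply: le_trans (enorm_le_sum _) _; apply: ler_sum => i _.
by rewrite mxE; case: (hK i) => _ /(_ z zB).
Qed.

Lemma C2_gradient_lipschitz p (g : 'cV[R]_p -> R) (B : R) : C2 g ->
  exists2 K : R, 0 <= K & forall x y, enorm x <= B -> enorm y <= B ->
    enorm (gradient g x - gradient g y) <= K * enorm (x - y).
Proof.
move=> [_ c2].
have /choice[K hK] : forall i : 'I_p, exists K : R, 0 <= K /\
    forall x y, enorm x <= B -> enorm y <= B ->
    `|'D_(delta_mx i 0) g x - 'D_(delta_mx i 0) g y| <= K * enorm (x - y).
  by move=> i; have [K ? ?] := C1_lipschitz B (c2 (delta_mx i 0)); exists K.
exists (\sum_i K i); first by apply: sumr_ge0 => i _; case: (hK i).
move=> x y xB yB.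
apply: le_trans (enorm_le_sum _) _; rewrite mulr_suml; apply: ler_sum => i _.
by rewrite !mxE; case: (hK i) => _ /(_ x y xB yB).
Qed.

End Gradient.

(** * The smallest positive eigenvalue of a Gram matrix *)

Section Rayleigh.
Variable R : realType.

Lemma quad_ge0_lin0 (b q : R) : (forall t, 0 <= t * b + t ^+ 2 * q) -> b = 0.
Proof.
move=> h; apply/eqP; rewrite -sqrf_eq0 eq_le sqr_ge0 andbT leNgt.
(* At [t = - b / c] the polynomial equals [b ^+ 2 * (q - c) / c ^+ 2], negative since [c > q]. *)
apply/negP => b0; set c := 2 * (`|q| + 1).
have c0 : 0 < c by rewrite mulr_gt0// ltr_wpDl.
have := mulr_ge0 (h (- b / c)) (ltW (exprn_gt0 2 c0)).
rewrite (_ : _ * c ^+ 2 = b ^+ 2 * (q - c)); last by field; rewrite gt_eqF.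
rewrite pmulr_rge0//; have := ler_norm q; rewrite /c; have := normr_ge0 q; lra.
Qed.

(** The unit sphere is compact, and nonempty as [0 < nc]; full row rank makes the minimum positive,
    and homogeneity extends the bound to every [w]. *)
Lemma rayleigh_min nc nz (Q : 'M[R]_(nc, nz)) : (0 < nc)%N -> row_free Q ->
  exists2 c : 'cV[R]_nc, enorm c = 1 &
    (0 < enorm (Q^T *m c) ^+ 2 /\
    forall w, enorm (Q^T *m c) ^+ 2 * enorm w ^+ 2 <= enorm (Q^T *m w) ^+ 2).
Proof.
move=> nc0 Qf; pose i0 := Ordinal nc0.
pose g (w : 'cV[R]_nc) := dotv w (Q *m Q^T *m w).
have gE w : g w = enorm (Q^T *m w) ^+ 2.
  by rewrite /g -mulmxA dotv_mulmxr enorm_sqr.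
have cS : compact [set w : 'cV[R]_nc | enorm w = 1].
  apply: subclosed_compact (@compact_enorm R nc 1) _ => [|w /= ->//].
  apply: (@preimage_closed _ _ (@enorm R nc) [set 1]) => [w _|].
    exact: continuous_enorm.
  exact: (@closed_eq R 1).
have [|c /set_mem/= c1 hc] := compact_EVT_min _ cS
   (continuous_subspaceT (@continuous_quad R nc (Q *m Q^T))).
  by exists (delta_mx i0 0); rewrite /= enorm_delta.
exists c => //; split.
  rewrite exprn_gt0// lt_neqAle enorm_ge0 eq_sym enorm_eq0 andbT.
  rewrite -trmx_eq0 trmx_mul trmxK mulmx_free_eq0// trmx_eq0 -enorm_eq0 c1.
  exact: oner_neq0.
move=> w; have [->|w0] := eqVneq w 0; first by rewrite mulmx0 !enorm0 expr0n mulr0.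
have nw : 0 < enorm w by rewrite lt_neqAle eq_sym enorm_eq0 w0 enorm_ge0.
have := hc ((enorm w)^-1 *: w); rewrite inE/= enormZ gtr0_norm ?invr_gt0//.
rewrite mulVf ?gt_eqF// => /(_ erefl); rewrite -!/(g _) !gE -scalemxAr enormZ.
rewrite gtr0_norm ?invr_gt0// exprMn exprVn.
by rewrite ler_pdivlMl ?exprn_gt0// mulrC.
Qed.

(* A minimizer [c] of the Rayleigh quotient of [Q Q^T] is an eigenvector, hence
   [Q^T c] is one of [Q^T Q] for the same eigenvalue. *)
Lemma lambda_min_posP nc nz (Q : 'M[R]_(nc, nz)) : (0 < nc)%N -> row_free Q ->
  0 < lambda_min_pos (Q^T *m Q) /\
  forall w, lambda_min_pos (Q^T *m Q) * enorm w ^+ 2 <= enorm (Q^T *m w) ^+ 2.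
Proof.
move=> nc0 Qf; have [c c1 []] := rayleigh_min nc0 Qf.
set l := enorm (Q^T *m c) ^+ 2 => l0 hl.
suff -> : lambda_min_pos (Q^T *m Q) = l by [].
have Mc : Q *m Q^T *m c = l *: c.
  apply/eqP; rewrite -subr_eq0 -dotv_eq0; move Eu: (_ - _) => u.
  suff : 2 * dotv u u = 0 by move/eqP; rewrite mulf_eq0 pnatr_eq0.
  (* First variation of [hl] at [c], where it is an equality, in the direction of the defect
     [u = Q Q^T c - l c]: the linear term is [2 * dotv u u]. *)
  apply: (@quad_ge0_lin0 _ (enorm (Q^T *m u) ^+ 2 - l * enorm u ^+ 2)) => t.
  have := hl (c + t *: u); rewrite mulmxDr -scalemxAr !enormD_sqr !enormZ c1.
  rewrite !exprMn !real_normK ?num_real// -/l !dotvZr.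
  rewrite dotv_mulmxl trmxK mulmxA.
  have -> : dotv c (Q *m Q^T *m u) = dotv (Q *m Q^T *m c) u.
    by rewrite dotv_mulmxr trmx_mul trmxK.
  have -> : Q *m Q^T *m c = u + l *: c by rewrite -Eu subrK.
  rewrite dotvDl dotvZl; nra.
(* For an eigenvector [v], [hl] at [Q v] compares [l |Q v|^2 = l a |v|^2] with [a^2 |v|^2]. *)
have lb a : eigenvalue (Q^T *m Q) a -> 0 < a -> l <= a.
  move=> /eigenvalueP[v vQ v0] a0.
  have v2 : 0 < enorm v^T ^+ 2.
    by rewrite exprn_gt0// lt_neqAle eq_sym enorm_eq0 trmx_eq0 v0 enorm_ge0.
  have hQ : Q^T *m (Q *m v^T) = a *: v^T.
    by apply: trmx_inj; rewrite !trmx_mul !trmxK linearZ/= trmxK -mulmxA vQ.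
  have := hl (Q *m v^T); rewrite hQ enormZ (enorm_sqr (Q *m _)).
  rewrite dotv_mulmxl hQ dotvZr -enorm_sqr exprMn real_normK ?num_real//.
  by rewrite mulrA ler_pM2r// expr2 ler_pM2r.
have el : eigenvalue (Q^T *m Q) l.
  apply/eigenvalueP; exists (Q^T *m c)^T.
    apply: trmx_inj; rewrite linearZ/= trmx_mul trmxK trmx_mul trmxK.
    by rewrite mulmxA -(mulmxA Q^T) -mulmxA Mc scalemxAr.
  rewrite trmx_eq0 -enorm_eq0; apply/negP => /eqP h.
  by move: l0; rewrite /l h expr0n ltxx.
have lbs : lbound [set a | eigenvalue (Q^T *m Q) a /\ 0 < a] l.
  by move=> a [ea a0]; exact: lb.
apply/eqP; rewrite eq_le; apply/andP; split.
  by apply: ge_inf => //; exists l.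
by apply: lb_le_inf => //; exists l.
Qed.

End Rayleigh.

(** * Blocks and Gauss-Seidel sweeps *)

Section Blocks.
Variables (R : realType) (n : nat) (dim : 'I_n -> nat).
Local Notation nx := (\sum_(i < n) dim i)%N.
Implicit Types x y : 'cV[R]_nx.

(** Kept in the full space, so that a vector is the sum of its blocks and a block update is the
    addition of one vector. *)
Definition blk (i : 'I_n) x : 'cV[R]_nx := set_block 0 i (submxcol x i).

Lemma submxcol_set_block x i (y : 'cV[R]_(dim i)) : submxcol (set_block x i y) i = y.
Proof. by rewrite /set_block mxcolK dfwithin. Qed.

Lemma submxcol_set_block_neq x i j (y : 'cV[R]_(dim i)) : i != j ->
  submxcol (set_block x i y) j = submxcol x j.
Proof. by move=> ij; rewrite /set_block mxcolK dfwithout. Qed.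

Lemma submxcol_blk x i : submxcol (blk i x) i = submxcol x i.
Proof. exact: submxcol_set_block. Qed.

Lemma submxcol_blk_neq x i j : i != j -> submxcol (blk i x) j = 0.
Proof. by move=> ij; rewrite submxcol_set_block_neq// submxcol0. Qed.

Lemma submxcolZ a x i : submxcol (a *: x) i = a *: submxcol x i.
Proof. by apply/matrixP => j k; rewrite !mxE. Qed.

Lemma blkD i x y : blk i (x + y) = blk i x + blk i y.
Proof.
apply/mxcolP => j; rewrite submxcolD; have [<-|ij] := eqVneq i j.
  by rewrite !submxcol_blk submxcolD.
by rewrite !submxcol_blk_neq// addr0.
Qed.

Lemma blkZ i a x : blk i (a *: x) = a *: blk i x.
Proof.
apply/mxcolP => j; rewrite submxcolZ; have [<-|ij] := eqVneq i j.
  by rewrite !submxcol_blk submxcolZ.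
by rewrite !submxcol_blk_neq// scaler0.
Qed.

Lemma blkN i x : blk i (- x) = - blk i x.
Proof. by rewrite -scaleN1r blkZ scaleN1r. Qed.

Lemma sum_blk x : \sum_i blk i x = x.
Proof.
apply/mxcolP => j; rewrite submxcol_sum (bigD1 j)//= submxcol_blk big1 ?addr0//.
by move=> i ij; rewrite submxcol_blk_neq.
Qed.

Lemma dotv_submxcol x y : dotv x y = \sum_i dotv (submxcol x i) (submxcol y i).
Proof.
rewrite dotvE -[x in LHS]submxcolK -[y in LHS]submxcolK tr_mxcol mul_mxrow_mxcol.
by rewrite summxE; apply: eq_bigr => i _; rewrite dotvE.
Qed.

Lemma enorm_blk_sqr i x : enorm (blk i x) ^+ 2 = enorm (submxcol x i) ^+ 2.
Proof.
rewrite !enorm_sqr dotv_submxcol (bigD1 i)//= submxcol_blk big1 ?addr0//.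
by move=> j ij; rewrite submxcol_blk_neq 1?eq_sym// dotv0r.
Qed.

Lemma sum_enorm_blk x : \sum_i enorm (blk i x) ^+ 2 = enorm x ^+ 2.
Proof.
rewrite [RHS]enorm_sqr dotv_submxcol; apply: eq_bigr => i _.
by rewrite enorm_blk_sqr enorm_sqr.
Qed.

Lemma enorm_blk_le i x : enorm (blk i x) <= enorm x.
Proof.
rewrite -(@ler_pXn2r _ 2) ?nnegrE ?enorm_ge0// -(sum_enorm_blk x) [leRHS](bigD1 i)//=.
by rewrite lerDl sumr_ge0// => j _; rewrite sqr_ge0.
Qed.

Lemma set_blockE x i y : set_block x i (submxcol y i) = x + blk i (y - x).
Proof.
apply/mxcolP => j; rewrite submxcolD; have [<-|ij] := eqVneq i j.
  by rewrite submxcol_set_block submxcol_blk submxcolB subrKC.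
by rewrite submxcol_set_block_neq// submxcol_blk_neq// addr0.
Qed.

(* The first [m] blocks are those of [x'], see [submxcol_sweep]; the sum makes
   the increments of a Gauss-Seidel pass explicit. *)
Definition sweep x x' (m : nat) : 'cV[R]_nx :=
  x + \sum_(j < n | (j < m)%N) blk j (x' - x).

Lemma sweep0 x x' : sweep x x' 0 = x.
Proof. by rewrite /sweep [X in _ + X]big_pred0 ?addr0. Qed.

Lemma sweep_full x x' : sweep x x' n = x'.
Proof.
rewrite /sweep [X in _ + X](eq_bigl xpredT) => [|j]; last exact: ltn_ord.
by rewrite sum_blk subrKC.
Qed.

Lemma sweepS x x' (i : 'I_n) : sweep x x' i.+1 = sweep x x' i + blk i (x' - x).
Proof.
rewrite /sweep -addrA; congr (_ + _); rewrite [LHS](bigD1 i)//= addrC; congr (_ + _).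
apply: eq_bigl => j; rewrite ltnS ltn_neqAle andbC; congr andb.
Qed.

Lemma submxcol_sweep x x' m j :
  submxcol (sweep x x' m) j = if (j < m)%N then submxcol x' j else submxcol x j.
Proof.
rewrite /sweep submxcolD submxcol_sum; case: ifPn => jm.
  rewrite [X in _ + X](bigD1 j)//= submxcol_blk submxcolB.
  rewrite [X in _ + (_ + X)]big1 ?addr0 ?subrKC//.
  by move=> i /andP[_ ij]; rewrite submxcol_blk_neq.
rewrite [X in _ + X]big1 ?addr0// => i im; rewrite submxcol_blk_neq//.
by apply: contraNneq jm => <-.
Qed.

Lemma partial_updateE x x' (i : 'I_n) : partial_update x' x i = sweep x x' i.
Proof. by apply/mxcolP => j; rewrite mxcolK submxcol_sweep. Qed.

Lemma enorm_sweep_le x x' m : enorm (x' - sweep x x' m) <= enorm (x' - x).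
Proof.
rewrite -(@ler_pXn2r _ 2) ?nnegrE ?enorm_ge0// !enorm_sqr !dotv_submxcol.
apply: ler_sum => j _; rewrite !submxcolB submxcol_sweep; case: ifP => // _.
by rewrite subrr dotv0r dotv_ge0.
Qed.

End Blocks.

(** * Multi-affine quadratic operators *)

Section QuadraticOperator.
Variables (R : realType) (n : nat) (dim : 'I_n -> nat) (nc : nat).
Local Notation nx := (\sum_(i < n) dim i)%N.
Variables (C : 'I_nc -> 'M[R]_nx) (d : 'I_nc -> 'cV[R]_nx) (e : 'I_nc -> R).
Local Notation A := (quad_op C d e).
Implicit Types u v h x : 'cV[R]_nx.

(** The polar form of the quadratic part, symmetrized because [C i] need not be symmetric; with this
    scaling the second-order term of [A] is half of [bilin h h]. *)
Definition bilin u v : 'cV[R]_nc :=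
  \col_i (2^-1 * (dotv u (C i *m v) + dotv v (C i *m u))).

(** The derivative of [A] at [x] in the direction [h], as [quad_opD] shows. *)
Definition jac x h : 'cV[R]_nc := bilin x h + \col_i dotv (d i) h.

Lemma bilinC u v : bilin u v = bilin v u.
Proof. by apply/colP => i; rewrite !mxE addrC. Qed.

Lemma bilinDr u v w : bilin u (v + w) = bilin u v + bilin u w.
Proof. by apply/colP => i; rewrite !mxE mulmxDr !dotv_lin; ring. Qed.

Lemma bilinZr a u v : bilin u (a *: v) = a *: bilin u v.
Proof. by apply/colP => i; rewrite !mxE -scalemxAr !dotv_lin; ring. Qed.

Lemma bilinZl a u v : bilin (a *: u) v = a *: bilin u v.
Proof. by rewrite bilinC bilinZr bilinC. Qed.

Lemma bilinBl u v w : bilin (u - v) w = bilin u w - bilin v w.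
Proof. by rewrite bilinC bilinDr -scaleN1r bilinZr scaleN1r !(bilinC w). Qed.

Lemma jacD x u v : jac x (u + v) = jac x u + jac x v.
Proof. by apply/colP => i; rewrite !mxE mulmxDr !dotv_lin; ring. Qed.

Lemma jacZ x a u : jac x (a *: u) = a *: jac x u.
Proof. by apply/colP => i; rewrite !mxE -scalemxAr !dotv_lin; ring. Qed.

Lemma jac0 x : jac x 0 = 0.
Proof. by rewrite -(scale0r 0) jacZ scale0r. Qed.

Lemma bilin0r u : bilin u 0 = 0.
Proof. by rewrite -(scale0r 0) bilinZr scale0r. Qed.

Lemma jac_sum x (F : 'I_n -> 'cV[R]_nx) :
  jac x (\sum_i F i) = \sum_i jac x (F i).
Proof. exact: (big_morph (jac x) (jacD x) (jac0 x)). Qed.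

Lemma jacB x y h : jac x h - jac y h = bilin (x - y) h.
Proof. by rewrite /jac opprD addrACA subrr addr0 bilinBl. Qed.

Lemma quad_opD x h : A (x + h) = A x + (jac x h + 2^-1 *: bilin h h).
Proof. by apply/colP => i; rewrite !mxE mulmxDr !dotv_lin; field. Qed.

Lemma enorm_bilin_le ep u v : (forall i, spectral_norm (C i) <= ep) ->
  enorm (bilin u v) <= nc%:R * ep * (enorm u * enorm v).
Proof.
move=> Cep; apply: le_trans (enorm_le_sum _) _.
rewrite -mulrA mulr_natl -[in leRHS](card_ord nc) -sumr_const.
apply: ler_sum => i _; rewrite mxE normrM ger0_norm ?invr_ge0//.
rewrite ler_pdivrMl//; apply: le_trans (ler_normD _ _) _.
have := quad_form_le u v (Cep i); have := quad_form_le v u (Cep i).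
rewrite (mulrC (enorm v)); lra.
Qed.

Lemma jac_bounded B ep : 0 <= B -> 0 <= ep ->
  (forall i, spectral_norm (C i) <= ep) ->
  exists2 K : R, 0 <= K & forall x h, enorm x <= B -> enorm (jac x h) <= K * enorm h.
Proof.
move=> B0 ep0 Cep; exists (nc%:R * ep * B + \sum_i enorm (d i)).
  by rewrite addr_ge0// ?mulr_ge0// sumr_ge0// => i _; rewrite enorm_ge0.
move=> x h xB; apply: le_trans (ler_enormD _ _) _; rewrite mulrDl; apply: lerD.
  apply: le_trans (enorm_bilin_le _ _ Cep) _.
  by rewrite mulrA ler_wpM2r ?enorm_ge0// ler_wpM2l// mulr_ge0.
apply: le_trans (enorm_le_sum _) _; rewrite mulr_suml; apply: ler_sum => i _.
by rewrite mxE cauchy_schwarz.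
Qed.

(** An affine map satisfies [g h + g (- h) = 2 g 0], whereas along a block the even part of [A]
    contains this quadratic term. Hence the residual is affine along each block. *)
Lemma multi_affine_bilin i h : multi_affine A -> bilin (blk i h) (blk i h) = 0.
Proof.
move=> /(_ i 0)[M [b hM]].
have h1 := hM (submxcol h i); have h2 := hM (submxcol (- h) i).
have h3 := hM (submxcol (0 *: h) i).
rewrite -!/(blk _ _) in h1 h2 h3; rewrite blkN in h2; rewrite blkZ in h3.
have e1 : A (blk i h) + A (- blk i h) = 2 *: A (0 *: blk i h).
  rewrite h1 h2 h3 submxcolN submxcolZ scale0r mulmx0 mulmxN add0r.
  by rewrite addrACA subrr add0r scaler_nat mulr2n.
apply/colP => j; move/colP: e1 => /(_ j).
by rewrite !mxE -scaleN1r -!scalemxAr !dotv_lin; lra.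
Qed.

End QuadraticOperator.

(** * Sequences that tend to zero *)

Section Vanishing.
Variable R : realType.
Implicit Types s t : nat -> R.

(** Only an upper bound is asked; for a nonnegative sequence this is convergence to 0. *)
Definition vanishing s := forall e, 0 < e -> exists N, forall k, (N <= k)%N -> s k <= e.

Lemma vanishing_le s t : (forall k, s k <= t k) -> vanishing t -> vanishing s.
Proof.
move=> st ht e e0; have [N hN] := ht e e0.
by exists N => k Nk; apply: le_trans (st k) (hN k Nk).
Qed.

Lemma vanishingD s t : vanishing s -> vanishing t -> vanishing (fun k => s k + t k).
Proof.
move=> hs ht e e0; have e2 : 0 < e / 2 by rewrite divr_gt0.
have [N hN] := hs _ e2; have [M hM] := ht _ e2.
exists (maxn N M) => k; rewrite geq_max => /andP[/hN ? /hM ?]; lra.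
Qed.

Lemma vanishingZ c s : 0 <= c -> vanishing s -> vanishing (fun k => c * s k).
Proof.
move=> c0 hs e e0; have e2 : 0 < e / (c + 1) by rewrite divr_gt0// ltr_wpDl.
have [N hN] := hs _ e2; exists N => k /hN h.
have : (c + 1) * s k <= e by rewrite mulrC -ler_pdivlMr// ltr_wpDl.
have [s0|s0] := leP 0 (s k); first by lra.
have := mulr_ge0 c0 (_ : 0 <= - s k); rewrite oppr_ge0 => /(_ (ltW s0)); lra.
Qed.

Lemma vanishing_sqrt s : vanishing (fun k => s k ^+ 2) -> vanishing s.
Proof.
move=> hs e e0; have [N hN] := hs _ (exprn_gt0 2 e0); exists N => k /hN.
by move=> h; rewrite leNgt; apply/negP => es; nra.
Qed.

(** Serves to pass to the limit in inequalities. *)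
Lemma vanishing_ge0 c s N : vanishing s -> (forall k, (N <= k)%N -> c <= s k) -> c <= 0.
Proof.
move=> hs cs; rewrite leNgt; apply/negP => c0.
have [M hM] := hs _ (divr_gt0 c0 (ltr0n R 2)).
have := cs (maxn N M) (leq_maxl _ _); have := hM (maxn N M) (leq_maxr _ _); lra.
Qed.

(** The values [l k] decrease to a limit, and [c * s k] is at most the distance of [l k] to it. *)
Lemma vanishing_descent s (l : nat -> R) c m : 0 < c ->
  (forall k, 0 <= s k) -> (forall k, l k.+1 + c * s k <= l k) -> (forall k, m <= l k) ->
  vanishing s.
Proof.
move=> c0 s0 ls ml.
have ld : nonincreasing_seq l.
  apply/nonincreasing_seqP => k; have := ls k; have := mulr_ge0 (ltW c0) (s0 k); lra.
have lc : cvgn l by apply: nonincreasing_is_cvgn => //; exists m => _ [k _ <-].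
have lge := nonincreasing_cvgn_ge ld lc.
move=> e e0; have /cvgrPdist_le/(_ (c * e)) := lc.
rewrite mulr_gt0// => /(_ isT)[N _ hN]; exists N => k Nk.
rewrite -(ler_pM2l c0); have := hN k Nk; have := lge k.+1; have := ls k.
by rewrite ler_norml => h1 h2 /andP[]; lra.
Qed.

End Vanishing.

(** * Convergence of bounded iterates *)

Section Step.
Variables (R : realType) (n : nat) (dim : 'I_n -> nat) (nz nc : nat).
Local Notation nx := (\sum_(i < n) dim i)%N.
Variables (f : 'cV[R]_nx -> R) (gf : 'cV[R]_nx -> 'cV[R]_nx) (mu_f : R).
Variables (phi : 'cV[R]_nz -> R) (gphi : 'cV[R]_nz -> 'cV[R]_nz) (mu_phi Lphi : R).
Variables (Q : 'M[R]_(nc, nz)) (lam rho : R).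
Variables (C : 'I_nc -> 'M[R]_nx) (d : 'I_nc -> 'cV[R]_nx) (e : 'I_nc -> R).
Variable (Xf : set 'cV[R]_nx).
Local Notation A := (quad_op C d e).
Hypotheses (mu_f_gt0 : 0 < mu_f) (mu_phi_gt0 : 0 < mu_phi).
Hypotheses (lam_gt0 : 0 < lam) (rho_gt0 : 0 < rho).
Hypothesis f_conv : forall x y,
  f x + dotv (gf x) (y - x) + mu_f / 2 * enorm (y - x) ^+ 2 <= f y.
Hypothesis gf_lip : forall B, exists2 K : R, 0 <= K & forall x y,
  enorm x <= B -> enorm y <= B -> enorm (gf x - gf y) <= K * enorm (x - y).
Hypothesis phi_conv : forall x y,
  phi x + dotv (gphi x) (y - x) + mu_phi / 2 * enorm (y - x) ^+ 2 <= phi y.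
Hypothesis gphi_lip : forall x y,
  enorm (gphi x - gphi y) <= Lphi * enorm (x - y).
Hypothesis lamP : forall w, lam * enorm w ^+ 2 <= enorm (Q^T *m w) ^+ 2.
Hypothesis rho_ge : 4 * Lphi ^+ 2 <= rho * mu_phi * lam.
Hypothesis A_affine : multi_affine A.
Hypothesis Xf_convex : forall x y (t : R), Xf x -> Xf y -> 0 <= t <= 1 ->
  Xf (x + t *: (y - x)).

Definition residual x z := A x + Q *m z.

(** The real part of the augmented Lagrangian; membership in the constraint set is carried
    separately by [Xf]. *)
Definition lagr x z w : R :=
  f x + (phi z + dotv w (residual x z) + rho / 2 * enorm (residual x z) ^+ 2).

Lemma residualD x z h g : residual (x + h) (z + g) =
  residual x z + (jac C d x h + Q *m g + 2^-1 *: bilin C h h).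
Proof.
rewrite /residual quad_opD mulmxDr.
move: (A x) (jac _ _ _ _) (_ *: bilin _ _ _) (Q *m z) (Q *m g) => a b c a' b'.
by apply/colP => i; rewrite !mxE; ring.
Qed.

Lemma aug_sqr (w r s : 'cV[R]_nc) :
  dotv w (r + s) + rho / 2 * enorm (r + s) ^+ 2 =
  dotv w r + rho / 2 * enorm r ^+ 2 + dotv (w + rho *: r) s
  + rho / 2 * enorm s ^+ 2.
Proof. by rewrite enormD_sqr !dotv_lin; field. Qed.

(** Strong convexity of [f] and [phi], and the exact expansion [aug_sqr] with its last square
    dropped. The term in [bilin C h h] is the only one of second order without a sign. *)
Lemma lagr_lower x z w h g :
  lagr x z w
  + (dotv (gf x) h + dotv (w + rho *: residual x z) (jac C d x h))
  + dotv (gphi z + Q^T *m (w + rho *: residual x z)) g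
  + mu_f / 2 * enorm h ^+ 2 + mu_phi / 2 * enorm g ^+ 2
  + 2^-1 * dotv (w + rho *: residual x z) (bilin C h h)
  <= lagr (x + h) (z + g) w.
Proof.
have := f_conv x (x + h); have := phi_conv z (z + g).
rewrite ![_ + _ - _]addrAC !subrr !add0r /lagr residualD => h1 h2.
set r := residual x z; set s := jac C d x h + Q *m g + 2^-1 *: bilin C h h.
have := aug_sqr w r s; have : 0 <= rho / 2 * enorm s ^+ 2.
  by rewrite mulr_ge0 ?sqr_ge0// ltW// divr_gt0.
have -> : dotv (w + rho *: r) s = dotv (w + rho *: r) (jac C d x h)
    + dotv (Q^T *m (w + rho *: r)) g + 2^-1 * dotv (w + rho *: r) (bilin C h h).
  by rewrite /s !(dotvDr (w + _)) dotvZr dotv_mulmxr.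
rewrite (dotvDl g (gphi z)); lra.
Qed.

Lemma ge0_of_quad (a K : R) :
  (forall t, 0 <= t <= 1 -> 0 <= t * a + t ^+ 2 * K) -> 0 <= a.
Proof.
move=> h; rewrite leNgt; apply/negP => a0.
pose t := Num.min 1 (- a / (2 * (`|K| + 1))).
have K0 : 0 < 2 * (`|K| + 1) by rewrite mulr_gt0// ltr_wpDl.
have t0 : 0 < t by rewrite lt_min ltr01 divr_gt0// oppr_gt0.
have t1 : t <= 1 by rewrite /t ge_min lexx.
have tK : t * (2 * (`|K| + 1)) <= - a by rewrite -ler_pdivlMr// /t ge_min lexx orbT.
have := h t; rewrite (ltW t0) t1 => /(_ isT).
rewrite expr2 -mulrA -mulrDr pmulr_rge0//; have := ler_norm K; nra.
Qed.

(* Strong convexity at [x + t h] bounds [f (x + t h) - f x] above by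
   [t <gf x, h> + O(t^2)], and the residual is affine along [h]. *)
Lemma first_order x z w h : bilin C h h = 0 ->
  (forall t, 0 <= t <= 1 -> lagr x z w <= lagr (x + t *: h) z w) ->
  0 <= dotv (gf x) h + dotv (w + rho *: residual x z) (jac C d x h).
Proof.
move=> h0 hmin; have [K K0 hK] := gf_lip (enorm x + enorm h).
set r := residual x z; set J := jac C d x h.
apply: (@ge0_of_quad _ (K * enorm h ^+ 2 + rho / 2 * enorm J ^+ 2)) => t t01.
have /andP[t0 t1] := t01.
have th : enorm (t *: h) <= enorm h.
  by rewrite enormZ ger0_norm// ler_piMl ?enorm_ge0.
have := hmin t t01; rewrite -{2}(addr0 z) /lagr residualD mulmx0 addr0.
rewrite bilinZl bilinZr h0 !scaler0 addr0 jacZ -/J -/r addr0.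
have := aug_sqr w r (t *: J); rewrite dotvZr enormZ exprMn real_normK ?num_real//.
have := f_conv (x + t *: h) x; rewrite opprD addNKr enormN dotvNr.
have := hK (x + t *: h) x; rewrite (le_trans (ler_enormD _ _)) ?lerD2l//.
rewrite lerDl enorm_ge0 => /(_ isT isT); rewrite addrAC subrr add0r => h1.
have := dotv_le (gf (x + t *: h) - gf x) (t *: h); rewrite dotvBl !dotvZr => h2.
have {}h2 : t * dotv (gf (x + t *: h)) h <= t * dotv (gf x) h + t ^+ 2 * (K * enorm h ^+ 2).
  have : enorm (gf (x + t *: h) - gf x) * enorm (t *: h) <= t ^+ 2 * (K * enorm h ^+ 2).
    rewrite (_ : _ * (K * _) = K * enorm (t *: h) * enorm (t *: h)).
      by rewrite ler_wpM2r ?enorm_ge0.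
    by rewrite enormZ ger0_norm//; ring.
  lra.
have : 0 <= mu_f / 2 * enorm (t *: h) ^+ 2.
  by rewrite mulr_ge0 ?sqr_ge0// divr_ge0// ltW.
lra.
Qed.

(* [sweep x x' i.+1] is the point reached after the update of block [i]; the
   condition on [gphi z'] is the optimality of the [z]-step, in which
   [w + rho *: residual x' z'] has been recognized as [w']. *)
Definition is_step x z w x' z' w' : Prop :=
  [/\ Xf x, Xf x',
      forall (i : 'I_n) y, Xf y -> lagr (sweep x x' i.+1) z w <=
                          lagr (sweep x x' i.+1 + blk i (y - x')) z w,
      gphi z' = - (Q^T *m w') & w' = w + rho *: residual x' z'].

(** The block is moved from [x'] towards [y]: the test points lie in [Xf] by convexity, and the
    residual is affine along the block. *)
Lemma step_first_order x z w x' z' w' (i : 'I_n) y :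
  is_step x z w x' z' w' -> Xf y -> let u := sweep x x' i.+1 in
  0 <= dotv (gf u) (blk i (y - x')) +
       dotv (w + rho *: residual u z) (jac C d u (blk i (y - x'))).
Proof.
move=> [_ Xx' hmin _ _] Xy; apply: first_order => [|t t01].
  exact: multi_affine_bilin A_affine.
have := hmin i _ (Xf_convex Xx' Xy t01).
by rewrite [x' + _ - x']addrAC subrr add0r blkZ.
Qed.

(** Optimality in [z] turns [Q^T (w' - w)] into a difference of gradients of [phi], and [lam] bounds
    [Q^T] from below. *)
Lemma dual_lip z w z' w' : gphi z = - (Q^T *m w) -> gphi z' = - (Q^T *m w') ->
  lam * enorm (w' - w) ^+ 2 <= Lphi ^+ 2 * enorm (z' - z) ^+ 2.
Proof.
move=> gz gz'; apply: le_trans (lamP _) _.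
rewrite mulmxBr -enormN opprB -[_ *m w]opprK -[_ *m w']opprK -gz -gz' opprK.
rewrite addrC -exprMn; have := gphi_lip z' z => h.
by rewrite ler_pXn2r// nnegrE ?enorm_ge0// (le_trans (enorm_ge0 _) h).
Qed.

Lemma step_descent x z w x' z' w' :
  is_step x z w x' z' w' -> gphi z = - (Q^T *m w) ->
  lagr x' z' w' + mu_f / 2 * enorm (x' - x) ^+ 2
    + mu_phi / 4 * enorm (z' - z) ^+ 2 <= lagr x z w.
Proof.
move=> st gz; have [Xx Xx' hmin gz' w'E] := st.
pose g m := lagr (sweep x x' m) z w.
(* The expansion is taken at the updated point, backwards along block [i]; its first-order part is
   nonnegative by optimality tested at [x]. *)
have hx (i : 'I_n) : mu_f / 2 * enorm (blk i (x' - x)) ^+ 2 <= g i - g i.+1.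
  have := step_first_order i st Xx; rewrite -[x - x']opprB blkN => /= fo.
  have := lagr_lower (sweep x x' i.+1) z w (- blk i (x' - x)) 0.
  have -> : sweep x x' i.+1 - blk i (x' - x) = sweep x x' i by rewrite sweepS addrK.
  rewrite addr0 dotv0r addr0 enorm0 expr0n/= mulr0 addr0 enormN.
  have -> : bilin C (- blk i (x' - x)) (- blk i (x' - x)) = 0.
    by rewrite -blkN; exact: multi_affine_bilin A_affine.
  by rewrite dotv0r mulr0 addr0 -/(g i) -/(g i.+1) => hl; lra.
have {}hx : mu_f / 2 * enorm (x' - x) ^+ 2 <= lagr x z w - lagr x' z w.
  rewrite -sum_enorm_blk mulr_sumr.
  have -> : lagr x z w - lagr x' z w = \sum_(i < n) (g i - g i.+1).
    rewrite -(big_mkord xpredT (fun i => g i - g i.+1)).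
    under eq_bigr do rewrite -opprB; rewrite sumrN telescope_sumr//.
    by rewrite opprB /g sweep0 sweep_full.
  by apply: ler_sum => i _; exact: hx.
have hz : mu_phi / 2 * enorm (z' - z) ^+ 2 <= lagr x' z w - lagr x' z' w.
  have := lagr_lower x' z' w 0 (z - z').
  rewrite addr0 subrKC -w'E gz' addNr dotv0l dotv0r enorm0 expr0n/=.
  rewrite jac0 bilin0r !dotv0r !mulr0 !addr0 enormC.
  by lra.
have hw : lagr x' z' w' = lagr x' z' w + rho * enorm (residual x' z') ^+ 2.
  by rewrite /lagr w'E dotvDl dotvZl -enorm_sqr; ring.
have := dual_lip gz gz'; rewrite w'E addrAC subrr add0r enormZ exprMn.
rewrite real_normK ?num_real//.
set r2 := enorm (residual _ _) ^+ 2 => hr.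
(* The dual update raises the Lagrangian by [rho * r2]. As [w' - w] is [rho] times the residual,
   [hr] and [rho_ge] bound this by half of the gain of the [z]-step. *)
have : rho * r2 <= mu_phi / 4 * enorm (z' - z) ^+ 2.
  rewrite -(ler_pM2l (mulr_gt0 (mulr_gt0 (ltr0n _ 4) rho_gt0) lam_gt0)).
  have := ler_wpM2r (sqr_ge0 (enorm (z' - z))) rho_ge; lra.
rewrite -w'E /r2; lra.
Qed.

(** Young's inequality with weight [c], followed by [(p + q)^2 <= 2 (p^2 + q^2)] and the same for
    [a], [b]. *)
Lemma young_sum (c M a b p q : R) : 0 < c -> 0 <= M ->
  M * (a + b) * (p + q) <= c * (p ^+ 2 + q ^+ 2) + M ^+ 2 / c * (a ^+ 2 + b ^+ 2).
Proof.
move=> c0 M0.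
have h : 0 <= (c * (p + q) - M * (a + b)) ^+ 2 / c.
  by rewrite mulr_ge0 ?sqr_ge0// invr_ge0 ltW.
have e1 : (c * (p + q) - M * (a + b)) ^+ 2 / c =
    c * (p + q) ^+ 2 - 2 * (M * (a + b) * (p + q)) + M ^+ 2 / c * (a + b) ^+ 2.
  by field; rewrite gt_eqF.
have Mc : 0 <= M ^+ 2 / c by rewrite divr_ge0 ?sqr_ge0// ltW.
have := mulr_ge0 (ltW c0) (sqr_ge0 (p - q)).
have := mulr_ge0 Mc (sqr_ge0 (a - b)).
rewrite e1 in h; lra.
Qed.

Lemma dual_lip_enorm : exists2 K : R, 0 <= K & forall z w z' w',
  gphi z = - (Q^T *m w) -> gphi z' = - (Q^T *m w') ->
  enorm (w' - w) <= K * enorm (z' - z).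
Proof.
exists (Num.sqrt (Lphi ^+ 2 / lam)); first exact: sqrtr_ge0.
move=> z w z' w' gz gz'.
rewrite -(@ler_pXn2r _ 2) ?nnegrE ?mulr_ge0 ?enorm_ge0 ?sqrtr_ge0//.
rewrite exprMn (@sqr_sqrtr _ (Lphi ^+ 2 / lam)); last by rewrite divr_ge0 ?sqr_ge0// ltW.
by rewrite mulrAC ler_pdivlMr// mulrC; exact: dual_lip.
Qed.

Lemma residualB_bounded B ep : 0 <= B -> 0 <= ep ->
  (forall i, spectral_norm (C i) <= ep) ->
  exists2 K : R, 0 <= K & forall x z x' z', enorm x <= B -> enorm x' <= B ->
    enorm (residual x' z' - residual x z) <= K * (enorm (x' - x) + enorm (z' - z)).
Proof.
move=> B0 ep0 Cep; have [KJ KJ0 hJ] := jac_bounded d B0 ep0 Cep.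
have [KQ KQ0 hQ] := mulmx_bounded Q.
exists (KJ + KQ + nc%:R * ep * B); first by rewrite !addr_ge0 ?mulr_ge0.
move=> x z x' z' xB x'B.
rewrite -{1}(subrKC x x') -{1}(subrKC z z') residualD addrAC subrr add0r.
set a := x' - x; set b := z' - z.
have aB : enorm a <= 2 * B by apply: le_trans (ler_enormB _ _) _; lra.
apply: le_trans (ler_enormD _ _) _; apply: le_trans (lerD (ler_enormD _ _) (lexx _)) _.
have := hJ x a xB; have := hQ b.
have := enorm_bilin_le a a Cep; rewrite (enormZ _ (bilin _ _ _)) ger0_norm ?invr_ge0//.
have := enorm_ge0 a; have := enorm_ge0 b; move: (enorm a) (enorm b) aB => p q pB.
move=> q0 p0 h1 h2 h3.
have nep : 0 <= nc%:R * ep by rewrite mulr_ge0.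
have : nc%:R * ep * (p * p) <= nc%:R * ep * (2 * B * p).
  by rewrite ler_wpM2l// ler_wpM2r.
have := mulr_ge0 KJ0 q0; have := mulr_ge0 KQ0 p0.
have := mulr_ge0 (mulr_ge0 nep B0) q0; lra.
Qed.

(* Sum over the blocks of the first-order conditions, each transported from
   [sweep x x' i.+1] to [x']. *)
Lemma step_stationary B ep : 0 <= B -> 0 <= ep ->
  (forall i, spectral_norm (C i) <= ep) ->
  exists2 K : R, 0 <= K & forall x z w x' z' w' y, is_step x z w x' z' w' ->
    enorm x <= B -> enorm x' <= B -> enorm w' <= B -> Xf y ->
    - (K * (enorm (x' - x) + enorm (z' - z)) * enorm (y - x')) <=
    dotv (gf x') (y - x') + dotv w' (jac C d x' (y - x')).
Proof.
(* Sweep points lie within [|x' - x| <= 2 B] of [x'], hence in the ball of radius [3 * B]. *)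
move=> B0 ep0 Cep; have B3 : 0 <= 3 * B by rewrite mulr_ge0.
have [KJ KJ0 hJ] := jac_bounded d B3 ep0 Cep.
have [Kr Kr0 hr] := residualB_bounded B3 ep0 Cep.
have [Kf Kf0 hf] := gf_lip (3 * B).
pose K := Kf + B * (nc%:R * ep) + rho * Kr * KJ.
have Br : 0 <= B * (nc%:R * ep) by rewrite !mulr_ge0.
have rK : 0 <= rho * Kr * KJ by rewrite !mulr_ge0// ltW.
have K0 : 0 <= K by rewrite !addr_ge0.
exists (n%:R * K); first by rewrite mulr_ge0.
move=> x z w x' z' w' y st xB x'B w'B Xy; have [_ _ _ _ w'E] := st.
set h := y - x'; rewrite -{2 3}(sum_blk h) jac_sum !dotv_sumr -big_split/=.
set s := enorm (x' - x) + enorm (z' - z).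
have -> : n%:R * K * s * enorm h = \sum_(i < n) K * s * enorm h.
  by rewrite sumr_const card_ord -[RHS]mulr_natl !mulrA.
rewrite -sumrN; apply: ler_sum => i _.
have := step_first_order i st Xy; rewrite -/h; set hi := blk i h.
set u := sweep x x' i.+1; set om := w + rho *: residual u z => /= fo.
have ux : enorm (x' - u) <= enorm (x' - x) := enorm_sweep_le x x' _.
have xx : enorm (x' - x) <= 2 * B by apply: le_trans (ler_enormB _ _) _; lra.
have uB : enorm u <= 3 * B.
  rewrite -[u](subKr x'); apply: le_trans (ler_enormB _ _) _; lra.
have x'B3 : enorm x' <= 3 * B by lra.
have hip : enorm hi <= enorm h := enorm_blk_le i h.
have us : enorm (x' - u) <= s by rewrite (le_trans ux)// lerDl enorm_ge0.
(* Three errors of the transport from [u] to [x']: in the gradient of [f] ([h1]), in the Jacobian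
   ([h2]) and in the multiplier ([h3]). *)
have h1 : - (Kf * s * enorm hi) <= dotv (gf x' - gf u) hi.
  apply: le_trans (dotv_geN _ _); rewrite lerN2 ler_wpM2r ?enorm_ge0//.
  by apply: le_trans (hf _ _ x'B3 uB) _; rewrite ler_wpM2l.
have h2 : - (B * (nc%:R * ep) * s * enorm hi) <=
    dotv w' (jac C d x' hi - jac C d u hi).
  apply: le_trans (dotv_geN _ _); rewrite lerN2 jacB -!mulrA.
  apply: ler_pM; rewrite ?enorm_ge0//.
  apply: le_trans (enorm_bilin_le _ _ Cep) _; rewrite -mulrA.
  by do 2 rewrite ler_wpM2l//; rewrite ler_wpM2r ?enorm_ge0.
have h3 : - (rho * Kr * KJ * s * enorm hi) <= dotv (w' - om) (jac C d u hi).
  apply: le_trans (dotv_geN _ _); rewrite lerN2.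
  have -> : w' - om = rho *: (residual x' z' - residual u z).
    by rewrite w'E /om opprD addrACA subrr add0r scalerBr.
  have -> : rho * Kr * KJ * s * enorm hi = rho * (Kr * s) * (KJ * enorm hi) by ring.
  rewrite enormZ gtr0_norm//.
  apply: ler_pM; rewrite ?enorm_ge0 ?mulr_ge0 ?enorm_ge0 ?(ltW rho_gt0)//; last exact: hJ.
  rewrite ler_pM2l//; apply: le_trans (hr _ _ _ _ uB x'B3) _.
  by rewrite ler_wpM2l// lerD2r.
have : K * s * enorm hi <= K * s * enorm h.
  by rewrite ler_wpM2l// mulr_ge0// addr_ge0 ?enorm_ge0.
move: h1 h2 h3 fo; rewrite !dotvBl dotvBr /K -/s; lra.
Qed.

(** [lagr_lower] at the new iterate: the first-order terms are at least [- O(d_k)] times the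
    displacement, which Young's inequality splits, and [mu_f] absorbs the curvature of the
    constraint. *)
Lemma step_key B ep : 0 <= B -> 0 <= ep ->
  (forall i, spectral_norm (C i) <= ep) -> nc%:R * ep * (3 * B) <= mu_f / 2 ->
  exists K c, [/\ 0 <= K, 0 < c & forall x z w x' z' w' y v,
    is_step x z w x' z' w' -> gphi z = - (Q^T *m w) ->
    enorm x <= B -> enorm x' <= B -> enorm w <= B -> enorm w' <= B -> Xf y ->
    lagr x' z' w' - K * (enorm (x' - x) ^+ 2 + enorm (z' - z) ^+ 2)
      + c * (enorm (y - x') ^+ 2 + enorm (v - z') ^+ 2) <= lagr y v w'].
Proof.
move=> B0 ep0 Cep epB.
have [KJ KJ0 hJ] := jac_bounded d B0 ep0 Cep.
have [KQ KQ0 hQ] := mulmx_bounded Q.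
have [Ks Ks0 hs] := step_stationary B0 ep0 Cep.
have [Kw Kw0 hw] := dual_lip_enorm.
pose M := Ks + Kw * KJ + Kw * KQ.
have M0 : 0 <= M by rewrite !addr_ge0 ?mulr_ge0.
(* The curvature leaves [mu_f / 4] of [mu_f / 2]; this pays [c] twice, in Young's inequality and in
   the conclusion. *)
pose c := Num.min (mu_f / 8) (mu_phi / 8).
have c0 : 0 < c by rewrite lt_min !divr_gt0.
have cf : c <= mu_f / 8 by rewrite ge_min lexx.
have cp : c <= mu_phi / 8 by rewrite ge_min lexx orbT.
exists (M ^+ 2 / c), c; split=> //; first by rewrite divr_ge0 ?sqr_ge0// ltW.
move=> x z w x' z' w' y v st gz xB x'B wB w'B Xy.
have [_ _ _ gz' w'E] := st.
(* The multiplier of the expansion is thus [w' + (w' - w)], of norm at most [3 * B], which explains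
   the smallness condition on [ep]. *)
have rE : rho *: residual x' z' = w' - w by rewrite w'E addrAC subrr add0r.
have := lagr_lower x' z' w' (y - x') (v - z'); rewrite !subrKC rE.
have := hs _ _ _ _ _ _ _ st xB x'B w'B Xy; set h := y - x'; set g := v - z'.
have -> : gphi z' + Q^T *m (w' + (w' - w)) = Q^T *m (w' - w).
  by rewrite mulmxDr gz' addKr.
rewrite dotv_mulmxl trmxK (dotvDl (jac _ _ _ _) w').
set a := enorm (x' - x); set b := enorm (z' - z) => h1.
have wb : enorm (w' - w) <= Kw * b := hw _ _ _ _ gz gz'.
have h2 : - (Kw * b * (KJ * enorm h)) <= dotv (w' - w) (jac C d x' h).
  apply: le_trans (dotv_geN _ _); rewrite lerN2.
  by apply: ler_pM; rewrite ?enorm_ge0//; exact: hJ.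
have h3 : - (Kw * b * (KQ * enorm g)) <= dotv (w' - w) (Q *m g).
  apply: le_trans (dotv_geN _ _); rewrite lerN2.
  by apply: ler_pM; rewrite ?enorm_ge0//; exact: hQ.
have h4 : - (mu_f / 2 * enorm h ^+ 2) <= dotv (w' + (w' - w)) (bilin C h h).
  apply: le_trans (dotv_geN _ _); rewrite lerN2.
  apply: le_trans (ler_pM (enorm_ge0 _) (enorm_ge0 _) (_ : _ <= 3 * B)
    (enorm_bilin_le _ _ Cep)) _.
    apply: le_trans (ler_enormD _ _) _; have := ler_enormB w' w; lra.
  rewrite mulrA (mulrC (3 * B)) -expr2 ler_wpM2r ?sqr_ge0//.
have := young_sum a b (enorm h) (enorm g) c0 M0.
have a0 : 0 <= a := enorm_ge0 _; have b0 : 0 <= b := enorm_ge0 _.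
have p0 := enorm_ge0 h; have q0 := enorm_ge0 g.
have : Ks * (a + b) * enorm h + Kw * b * (KJ * enorm h) + Kw * b * (KQ * enorm g)
    <= M * (a + b) * (enorm h + enorm g).
  have := mulr_ge0 (mulr_ge0 Kw0 KJ0) (mulr_ge0 a0 p0).
  have := mulr_ge0 (mulr_ge0 Kw0 KQ0) (mulr_ge0 a0 p0).
  have := mulr_ge0 (mulr_ge0 Kw0 KQ0) (mulr_ge0 b0 p0).
  have := mulr_ge0 (mulr_ge0 Kw0 KJ0) (mulr_ge0 a0 q0).
  have := mulr_ge0 (mulr_ge0 Kw0 KJ0) (mulr_ge0 b0 q0).
  have := mulr_ge0 (mulr_ge0 Kw0 KQ0) (mulr_ge0 a0 q0).
  have := mulr_ge0 Ks0 (mulr_ge0 a0 q0); have := mulr_ge0 Ks0 (mulr_ge0 b0 q0).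
  rewrite /M; lra.
have := ler_wpM2r (sqr_ge0 (enorm h)) cf.
have := ler_wpM2r (sqr_ge0 (enorm g)) cp.
have := mulr_ge0 (ltW mu_phi_gt0) (sqr_ge0 (enorm g)); lra.
Qed.

(** * Sequences of steps that stay in a ball *)

Section Sequence.
Variables (xs : nat -> 'cV[R]_nx) (zs : nat -> 'cV[R]_nz) (ws : nat -> 'cV[R]_nc).
Variables (B ep : R).
Hypotheses (B_ge0 : 0 <= B) (ep_ge0 : 0 <= ep).
Hypothesis C_le : forall i, spectral_norm (C i) <= ep.
Hypothesis ep_small : nc%:R * ep * (3 * B) <= mu_f / 2.
Hypothesis Xf_closed : forall u l, (forall k, Xf (u k)) ->
  vanishing (fun k => enorm (u k - l)) -> Xf l.
Hypothesis steps : forall k,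
  is_step (xs k) (zs k) (ws k) (xs k.+1) (zs k.+1) (ws k.+1).
Hypothesis gphi0 : gphi (zs 0) = - (Q^T *m ws 0).
Hypotheses (xs_le : forall k, enorm (xs k) <= B) (zs_le : forall k, enorm (zs k) <= B).
Hypothesis ws_le : forall k, enorm (ws k) <= B.

Let gap k := enorm (xs k.+1 - xs k) ^+ 2 + enorm (zs k.+1 - zs k) ^+ 2.
Let Lk k := lagr (xs k) (zs k) (ws k).
Let res k := residual (xs k) (zs k).
Let c1 := Num.min (mu_f / 2) (mu_phi / 4).

Let c1_gt0 : 0 < c1.
Proof. by rewrite lt_min !divr_gt0. Qed.

Let gap_ge0 k : 0 <= gap k.
Proof. by rewrite addr_ge0 ?sqr_ge0. Qed.

Let gphi_ws k : gphi (zs k) = - (Q^T *m ws k).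
Proof. by case: k => [//|k]; case: (steps k). Qed.

Let Lk_descent k : Lk k.+1 + c1 * gap k <= Lk k.
Proof.
have := step_descent (steps k) (gphi_ws k).
have := ler_wpM2r (sqr_ge0 (enorm (xs k.+1 - xs k))) (_ : c1 <= mu_f / 2).
have := ler_wpM2r (sqr_ge0 (enorm (zs k.+1 - zs k))) (_ : c1 <= mu_phi / 4).
rewrite !ge_min !lexx orbT => /(_ isT) h1 /(_ isT) h2.
rewrite /Lk /gap; lra.
Qed.

Let Lk_le j k : Lk (j + k)%N <= Lk j.
Proof.
elim: k => [|k ih]; first by rewrite addn0.
rewrite addnS; have := Lk_descent (j + k).
have := mulr_ge0 (ltW c1_gt0) (gap_ge0 (j + k)); lra.
Qed.

Let rho_res k : rho *: res k.+1 = ws k.+1 - ws k.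
Proof. by case: (steps k) => _ _ _ _ {1}->; rewrite addrAC subrr add0r. Qed.

Let res_le : exists2 K : R, 0 <= K & forall k, enorm (res k.+1) <= K * enorm (zs k.+1 - zs k).
Proof.
have [K K0 hK] := dual_lip_enorm; exists (K / rho); first by rewrite divr_ge0// ltW.
move=> k; rewrite mulrAC ler_pdivlMr// mulrC -(gtr0_norm rho_gt0) -enormZ rho_res.
exact: hK.
Qed.

(** Used at the origin to bound the values from below, and at the limit point to show that they stay
    above the limit value. *)
Lemma lagr_ge x z w (xl : 'cV[R]_nx) (zl : 'cV[R]_nz) :
  f xl + phi zl - (enorm (gf xl) * enorm (x - xl) + enorm (gphi zl) * enorm (z - zl)
    + enorm w * enorm (residual x z)) <= lagr x z w.
Proof.
have := f_conv xl x; have := phi_conv zl z; rewrite /lagr.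
have := dotv_geN (gf xl) (x - xl); have := dotv_geN (gphi zl) (z - zl).
have := dotv_geN w (residual x z).
have := mulr_ge0 (divr_ge0 (ltW mu_f_gt0) (ler0n R 2)) (sqr_ge0 (enorm (x - xl))).
have := mulr_ge0 (divr_ge0 (ltW mu_phi_gt0) (ler0n R 2)) (sqr_ge0 (enorm (z - zl))).
have := mulr_ge0 (divr_ge0 (ltW rho_gt0) (ler0n R 2)) (sqr_ge0 (enorm (residual x z))).
lra.
Qed.

Let Lk_lb : exists m, forall k, m <= Lk k.
Proof.
exists (f 0 + phi 0 - (enorm (gf 0) * B + enorm (gphi 0) * B + B * (2 * B / rho))) => k.
(* The shift by one makes the residual a multiplier increment divided by [rho], which is bounded. *)
apply: le_trans (_ : Lk k.+1 <= _); last by rewrite -addn1; exact: Lk_le.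
apply: le_trans (lagr_ge _ _ _ 0 0); rewrite lerD2l lerN2 !subr0.
have r_le : enorm (residual (xs k.+1) (zs k.+1)) <= 2 * B / rho.
  rewrite ler_pdivlMr// mulrC -(gtr0_norm rho_gt0) -enormZ [_ *: _]rho_res.
  apply: le_trans (ler_enormB _ _) _; have := ws_le k; have := ws_le k.+1; lra.
by rewrite !lerD ?ler_wpM2l ?ler_pM ?enorm_ge0.
Qed.

Let gap_vanishing : vanishing gap.
Proof.
have [m hm] := Lk_lb.
exact: (vanishing_descent c1_gt0 gap_ge0 Lk_descent hm).
Qed.

Let dz_vanishing : vanishing (fun k => enorm (zs k.+1 - zs k)).
Proof.
apply: vanishing_sqrt; apply: vanishing_le gap_vanishing => k.
by rewrite /gap lerDr sqr_ge0.
Qed.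

Let res_vanishing : vanishing (fun k => enorm (res k.+1)).
Proof.
by have [K K0 hK] := res_le; apply: vanishing_le hK (vanishingZ K0 dz_vanishing).
Qed.

(* Add the key inequality at step [k], tested at iterate [l], and the same with
   [k] and [l] exchanged. *)
Let pair_bound : exists2 s : nat -> R, vanishing s & forall k l,
  enorm (xs k.+1 - xs l.+1) ^+ 2 + enorm (zs k.+1 - zs l.+1) ^+ 2 <= s k + s l.
Proof.
have [K [c [K0 c0 key]]] := step_key B_ge0 ep_ge0 C_le ep_small.
exists (fun k => (2 * c)^-1 * (K * gap k + 2 * B * enorm (res k.+1))).
  apply: vanishingZ; first by rewrite invr_ge0 mulr_ge0// ltW.
  by apply: vanishingD; apply: vanishingZ => //; rewrite mulr_ge0.
move=> k l; rewrite -mulrDr ler_pdivlMl ?mulr_gt0//.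
have Xxs j : Xf (xs j) by case: (steps j).
(* The two key inequalities carry different multipliers; the exchange costs a product with the
   residual, which vanishes. *)
have lagr_w w w' j : lagr (xs j) (zs j) w' = lagr (xs j) (zs j) w + dotv (w' - w) (res j).
  by rewrite /lagr dotvBl -/(res j); ring.
have := key _ _ _ _ _ _ (xs l.+1) (zs l.+1) (steps k) (gphi_ws k)
  (xs_le k) (xs_le _) (ws_le _) (ws_le _) (Xxs _).
have := key _ _ _ _ _ _ (xs k.+1) (zs k.+1) (steps l) (gphi_ws l)
  (xs_le l) (xs_le _) (ws_le _) (ws_le _) (Xxs _).
rewrite (lagr_w (ws l.+1) (ws k.+1) l.+1) (lagr_w (ws k.+1) (ws l.+1) k.+1).
rewrite -/(gap k) -/(gap l) (enormC (xs l.+1)) (enormC (zs l.+1)).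
have wB : enorm (ws k.+1 - ws l.+1) <= 2 * B.
  apply: le_trans (ler_enormB _ _) _; have := ws_le k.+1; have := ws_le l.+1; lra.
have := dotv_le (ws k.+1 - ws l.+1) (res l.+1).
have := dotv_le (ws l.+1 - ws k.+1) (res k.+1); rewrite (enormC (ws l.+1)).
have := ler_wpM2r (enorm_ge0 (res l.+1)) wB.
have := ler_wpM2r (enorm_ge0 (res k.+1)) wB.
lra.
Qed.

Let xs_zs_limit : exists xl zl, vanishing (fun k => enorm (xs k.+1 - xl)) /\
  vanishing (fun k => enorm (zs k.+1 - zl)).
Proof.
have [s vs hs] := pair_bound.
have cauchy p (u : nat -> 'cV[R]_p) :
    (forall k l, enorm (u k - u l) ^+ 2 <= s k + s l) ->
    exists l, vanishing (fun k => enorm (u k - l)).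
  move=> us; have [|l hl] := @cauchy_enorm _ _ u; last by exists l.
  move=> eps e0; have [N hN] := vs _ (divr_gt0 (exprn_gt0 2 e0) (ltr0n R 2)).
  exists N => k l /hN sk /hN sl.
  rewrite -(@ler_pXn2r _ 2) ?nnegrE ?enorm_ge0 ?(ltW e0)//.
  apply: le_trans (us k l) _; lra.
have [|xl hx] := cauchy _ (fun k => xs k.+1).
  by move=> k l; apply: le_trans (hs k l); rewrite lerDl sqr_ge0.
have [|zl hz] := cauchy _ (fun k => zs k.+1).
  by move=> k l; apply: le_trans (hs k l); rewrite lerDr sqr_ge0.
by exists xl, zl.
Qed.

Theorem admm_convergence : exists xl zl (q M : R),
  [/\ vanishing (fun k => enorm (xs k.+1 - xl)),
      vanishing (fun k => enorm (zs k.+1 - zl)),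
      [/\ 0 < q, q < 1 & 0 <= M],
      (forall k y v, Xf y ->
        lagr (xs k.+1) (zs k.+1) (ws k.+1) <= lagr y v (ws k.+1) + M * q ^+ k) &
      [/\ Xf xl, residual xl zl = 0 & forall y v, Xf y -> residual y v = 0 ->
        f xl + phi zl <= f y + phi v]].
Proof.
have [xl [zl [vx vz]]] := xs_zs_limit.
have [K [c [K0 c0 key]]] := step_key B_ge0 ep_ge0 C_le ep_small.
have {}key k y v : Xf y -> Lk k.+1 <= lagr y v (ws k.+1) + K * gap k.
  move=> Xy; have := key _ _ _ _ _ _ y v (steps k) (gphi_ws k)
    (xs_le k) (xs_le _) (ws_le _) (ws_le _) Xy.
  have := mulr_ge0 (ltW c0) (addr_ge0 (sqr_ge0 (enorm (y - xs k.+1)))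
    (sqr_ge0 (enorm (v - zs k.+1)))).
  rewrite -/(Lk k.+1) -/(gap k); lra.
have Xxl : Xf xl.
  by apply: (Xf_closed (u := fun k => xs k.+1)) vx => k; case: (steps k).
(* The residual is Lipschitz on bounded sets, and it vanishes along the iterates. *)
have rl : residual xl zl = 0.
  have xlB : enorm xl <= B + 1.
    have [N /(_ N (leqnn _)) hN] := vx 1 ltr01.
    rewrite -[xl](subKr (xs N.+1)); apply: le_trans (ler_enormB _ _) _.
    by have := xs_le N.+1; lra.
  have [Kr Kr0 hr] := residualB_bounded (addr_ge0 B_ge0 ler01) ep_ge0 C_le.
  apply/eqP; rewrite -enorm_eq0 eq_le enorm_ge0 andbT.
  apply: (vanishing_ge0 (N := 0)
    (vanishingD res_vanishing (vanishingZ Kr0 (vanishingD vx vz)))).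
  move=> k _; rewrite -[residual xl zl](subKr (res k.+1)).
  apply: le_trans (ler_enormB _ _) _; rewrite lerD2l.
  by apply: hr => //; have := xs_le k.+1; lra.
have lagr_feas y v w : residual y v = 0 -> lagr y v w = f y + phi v.
  by move=> r0; rewrite /lagr r0 dotv0r enorm0 expr0n/= mulr0 !addr0.
pose Ll := f xl + phi zl.
have Ll_le k : Ll <= Lk k.
  rewrite -subr_le0.
  apply: (vanishing_ge0 (N := k) (vanishingD (vanishingD
    (vanishingZ (enorm_ge0 (gf xl)) vx) (vanishingZ (enorm_ge0 (gphi zl)) vz))
    (vanishingZ B_ge0 res_vanishing))) => j kj.
  have := lagr_ge (xs j.+1) (zs j.+1) (ws j.+1) xl zl; rewrite -/(Lk j.+1) -/(res _) -/Ll.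
  have := Lk_le k (j.+1 - k); rewrite subnKC ?(leq_trans kj)//.
  have := ler_wpM2r (enorm_ge0 (res j.+1)) (ws_le j.+1); lra.
pose b k := Lk k - Ll.
have b0 k : 0 <= b k by rewrite subr_ge0.
(* The key inequality at the limit and descent give [b k.+1 <= K1 * (b k - b k.+1)], hence the ratio
   [K1 / (1 + K1)]; [K + 1] keeps it positive. *)
pose K1 := (K + 1) / c1.
have K10 : 0 < K1 by rewrite divr_gt0// ltr_wpDl.
have K11 : 0 < 1 + K1 by rewrite ltr_wpDl.
pose q := K1 / (1 + K1).
have q0 : 0 < q by rewrite divr_gt0.
have gapb k : gap k <= (b k - b k.+1) / c1.
  by rewrite ler_pdivlMr// mulrC /b; have := Lk_descent k; lra.
have bq k : b k.+1 <= q * b k.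
  rewrite /q mulrAC ler_pdivlMr//.
  have := key k _ zl Xxl; rewrite (lagr_feas _ _ _ rl) -/Ll => h.
  have : K * gap k <= K1 * (b k - b k.+1).
    apply: le_trans (_ : (K + 1) * gap k <= _).
      by rewrite ler_wpM2r// lerDl.
    by rewrite /K1 mulrAC -mulrA ler_wpM2l// addr_ge0.
  rewrite {1}/b in h *; rewrite /b in h *; lra.
have bqk k : b k <= b 0%N * q ^+ k.
  elim: k => [|k ih]; first by rewrite expr0 mulr1.
  by apply: le_trans (bq k) _; rewrite exprS mulrCA ler_wpM2l// ltW.
exists xl, zl, q, (K * (b 0%N / c1)); split=> //.
- split=> //; first by rewrite ltr_pdivrMr// mul1r ltrDr.
  by rewrite mulr_ge0// divr_ge0// ltW.
- move=> k y v Xy; apply: le_trans (key k y v Xy) _; rewrite lerD2l -mulrA ler_wpM2l//.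
  apply: le_trans (gapb k) _; rewrite mulrAC ler_pM2r ?invr_gt0//.
  have := bqk k; have := b0 k.+1; lra.
- split=> // y v Xy r0; rewrite -subr_le0.
  apply: (vanishing_ge0 (N := 0) (vanishingZ K0 gap_vanishing)) => k _.
  have := key k y v Xy; rewrite (lagr_feas _ _ _ r0).
  have := Ll_le k.+1; rewrite /Ll; lra.
Qed.

End Sequence.

End Step.

(** * Bounds uniform in the quadratic part *)

Section Bounds.
Variables (R : realType) (n : nat) (dim : 'I_n -> nat) (nz nc : nat).
Local Notation nx := (\sum_(i < n) dim i)%N.
Variables (f : 'cV[R]_nx -> R) (gf : 'cV[R]_nx -> 'cV[R]_nx) (mu_f : R).
Variables (phi : 'cV[R]_nz -> R) (gphi : 'cV[R]_nz -> 'cV[R]_nz) (mu_phi Lphi : R).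
Variables (Q : 'M[R]_(nc, nz)) (lam rho : R).
Variables (d : 'I_nc -> 'cV[R]_nx) (e : 'I_nc -> R).
Hypotheses (nc_gt0 : (0 < nc)%N) (mu_f_gt0 : 0 < mu_f) (mu_phi_gt0 : 0 < mu_phi).
Hypotheses (lam_gt0 : 0 < lam) (rho_gt0 : 0 < rho).
Hypothesis f_conv : forall x y,
  f x + dotv (gf x) (y - x) + mu_f / 2 * enorm (y - x) ^+ 2 <= f y.
Hypothesis phi_conv : forall x y,
  phi x + dotv (gphi x) (y - x) + mu_phi / 2 * enorm (y - x) ^+ 2 <= phi y.
Hypothesis gphi_lip : forall x y,
  enorm (gphi x - gphi y) <= Lphi * enorm (x - y).
Hypothesis lamP : forall w, lam * enorm w ^+ 2 <= enorm (Q^T *m w) ^+ 2.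
Hypothesis rho_ge : 4 * Lphi ^+ 2 <= rho * mu_phi * lam.
Local Notation res C := (residual Q C d e).
Local Notation L C := (lagr f phi Q rho C d e).

(** Completing the square absorbs the linear term into half of the quadratic one. *)
Lemma quad_growth p (g : 'cV[R]_p -> R) (gg : 'cV[R]_p -> 'cV[R]_p) mu x :
  0 < mu -> (forall x y,
    g x + dotv (gg x) (y - x) + mu / 2 * enorm (y - x) ^+ 2 <= g y) ->
  g 0 - enorm (gg 0) ^+ 2 / mu + mu / 4 * enorm x ^+ 2 <= g x.
Proof.
move=> mu0 /(_ 0 x); rewrite subr0; have := dotv_geN (gg 0) x.
have : 0 <= (mu / 2 * enorm x - enorm (gg 0)) ^+ 2 / mu.
  by rewrite divr_ge0 ?sqr_ge0// ltW.
have -> : (mu / 2 * enorm x - enorm (gg 0)) ^+ 2 / mu =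
    mu / 4 * enorm x ^+ 2 - enorm (gg 0) * enorm x + enorm (gg 0) ^+ 2 / mu.
  by field; rewrite gt_eqF.
lra.
Qed.

(** Keeps square roots out of the radii below. *)
Lemma le_of_sqr (a M : R) : a ^+ 2 <= M -> a <= 1 + M.
Proof. by have := sqr_ge0 (a - 1); have := sqr_ge0 a; rewrite sqrrB1 => ? ?; lra. Qed.

(** Sum of the strong convexity inequalities between 0 and [g]. The point [g] must be nonzero, and
    [Q^T] of a unit vector is. *)
Lemma mu_le_lip : mu_phi <= Lphi.
Proof.
pose w : 'cV[R]_nc := delta_mx (Ordinal nc_gt0) 0; pose g := Q^T *m w.
have g0 : 0 < enorm g ^+ 2.
  by apply: lt_le_trans (lamP w); rewrite enorm_delta expr1n mulr1.
rewrite -(ler_pM2r g0).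
have := phi_conv 0 g; have := phi_conv g 0; rewrite subr0 sub0r enormN dotvNr.
have := dotv_le (gphi g - gphi 0) g; rewrite dotvBl.
have := ler_wpM2r (enorm_ge0 g) (gphi_lip g 0); rewrite subr0; lra.
Qed.

Lemma gram_unit : Q *m Q^T \in unitmx.
Proof.
rewrite -row_free_unit; apply: inj_row_free => v vQ.
have : Q *m Q^T *m v^T = 0.
  by apply: trmx_inj; rewrite trmx_mul trmx_mul !trmxK vQ trmx0.
move=> h; apply/eqP; rewrite -trmx_eq0 -enorm_eq0 -sqrf_eq0 eq_le sqr_ge0 andbT.
rewrite -(pmulr_rle0 _ lam_gt0); apply: le_trans (lamP _) _.
by rewrite enorm_sqr dotv_mulmxl trmxK mulmxA h dotv0r.
Qed.

(* [g] solves [Q g = A x + Q z], so that [(x, z - g)] satisfies the constraint. *)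
Lemma lagr_coercive C x z w : gphi z = - (Q^T *m w) ->
  exists2 g, enorm g ^+ 2 <= enorm (res C x z) ^+ 2 / lam &
  f x + phi (z - g) + rho / 4 * enorm (res C x z) ^+ 2 <= L C x z w.
Proof.
move=> gz; set r := res C x z.
(* The least-norm solution of [Q g = r]. *)
pose s := invmx (Q *m Q^T) *m r; pose g := Q^T *m s.
have Qg : Q *m g = r by rewrite /g /s mulmxA mulKVmx// gram_unit.
have sr : enorm g ^+ 2 = dotv s r by rewrite -Qg dotv_mulmxr enorm_sqr.
have gr : enorm g ^+ 2 <= enorm r ^+ 2 / lam.
  rewrite ler_pdivlMr//.
  have [g0|g0] := eqVneq (enorm g) 0; first by rewrite g0 expr0n mul0r sqr_ge0.
  have g2 : 0 < enorm g ^+ 2 by rewrite exprn_even_gt0.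
  rewrite -(ler_pM2l g2).
  have h1 : (enorm g ^+ 2) ^+ 2 <= enorm s ^+ 2 * enorm r ^+ 2.
    by rewrite -exprMn ler_pXn2r ?nnegrE ?sqr_ge0 ?mulr_ge0 ?enorm_ge0// sr dotv_le.
  have := ler_wpM2l (ltW lam_gt0) h1; have := ler_wpM2r (sqr_ge0 (enorm r)) (lamP s).
  rewrite -/g; lra.
exists g => //; rewrite /lagr -/r.
have wr : dotv w r = - dotv (gphi z) g.
  by rewrite -Qg dotv_mulmxr gz dotvNl opprK.
have := phi_conv (z - g) z; rewrite subKr.
have := dotv_geN (gphi (z - g) - gphi z) g; rewrite dotvBl.
have := ler_wpM2r (enorm_ge0 g) (gphi_lip (z - g) z).
rewrite [z - g - z]addrAC subrr sub0r enormN.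
have Lphi0 : 0 < Lphi by apply: lt_le_trans mu_le_lip.
(* This lets a quarter of [rho |r|^2] pay for [Lphi |g|^2], the error of replacing [gphi z] by
   [gphi (z - g)]. *)
have Llam : 4 * Lphi <= rho * lam.
  have : 4 * Lphi * Lphi <= rho * lam * Lphi.
    have := ler_wpM2l (ltW (mulr_gt0 rho_gt0 lam_gt0)) mu_le_lip; have := rho_ge; lra.
  by rewrite ler_pM2r.
have : Lphi * enorm g ^+ 2 <= rho / 4 * enorm r ^+ 2.
  have h := ler_wpM2l (ltW Lphi0) gr; apply: le_trans h _.
  rewrite mulrCA mulrC ler_wpM2r ?sqr_ge0// ler_pdivrMr//; lra.
have := mulr_ge0 (ltW mu_phi_gt0) (sqr_ge0 (enorm g)).
lra.
Qed.

(** Coercivity bounds [x], [z - g] and the residual, hence [g] and [z]; then [Q^T w = - gphi z]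
    bounds [w]. The radius is chosen before [C]. *)
Lemma sublevel_bounded K1 : exists2 B : R, 0 <= B & forall C x z w,
  gphi z = - (Q^T *m w) -> L C x z w <= K1 ->
  [/\ enorm x <= B, enorm z <= B & enorm w <= B].
Proof.
pose M := `|K1 - (f 0 - enorm (gf 0) ^+ 2 / mu_f) - (phi 0 - enorm (gphi 0) ^+ 2 / mu_phi)|.
pose Bx := 1 + M / (mu_f / 4).
pose Bz := 1 + M / (mu_phi / 4) + (1 + M / (rho / 4) / lam).
pose Bw := 1 + (enorm (gphi 0) + Lphi * Bz) ^+ 2 / lam.
have M0 : 0 <= M := normr_ge0 _.
have Lphi0 : 0 < Lphi by apply: lt_le_trans mu_le_lip.
have Bx0 : 0 <= Bx by rewrite addr_ge0// divr_ge0// divr_ge0// ltW.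
have Bz0 : 0 <= Bz by rewrite !addr_ge0// !divr_ge0// ltW.
have Bw0 : 0 <= Bw by rewrite addr_ge0// divr_ge0 ?sqr_ge0// ltW.
exists (Bx + Bz + Bw) => [|C x z w gz LK]; first exact: addr_ge0 (addr_ge0 Bx0 Bz0) Bw0.
have [g gr Lge] := lagr_coercive C x gz.
have fx := quad_growth x mu_f_gt0 f_conv.
have pz := quad_growth (z - g) mu_phi_gt0 phi_conv.
have MK : K1 - (f 0 - enorm (gf 0) ^+ 2 / mu_f)
    - (phi 0 - enorm (gphi 0) ^+ 2 / mu_phi) <= M := ler_norm _.
have x2 := mulr_ge0 (divr_ge0 (ltW mu_f_gt0) (ler0n R 4)) (sqr_ge0 (enorm x)).
have z2 := mulr_ge0 (divr_ge0 (ltW mu_phi_gt0) (ler0n R 4)) (sqr_ge0 (enorm (z - g))).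
have r2 := mulr_ge0 (divr_ge0 (ltW rho_gt0) (ler0n R 4)) (sqr_ge0 (enorm (res C x z))).
have xB : enorm x <= Bx.
  by apply: le_of_sqr; rewrite ler_pdivlMr ?divr_gt0// mulrC; lra.
have zB : enorm z <= Bz.
  rewrite -[z](subrK g); apply: le_trans (ler_enormD _ _) _; apply: lerD.
    by apply: le_of_sqr; rewrite ler_pdivlMr ?divr_gt0// mulrC; lra.
  apply: le_of_sqr; apply: le_trans gr _; rewrite ler_pM2r ?invr_gt0//.
  by rewrite ler_pdivlMr ?divr_gt0// mulrC; lra.
have wB : enorm w <= Bw.
  apply: le_of_sqr; rewrite ler_pdivlMr// mulrC; apply: le_trans (lamP w) _.
  rewrite -enormN -gz ler_pXn2r ?nnegrE ?enorm_ge0//; last first.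
    by rewrite addr_ge0 ?enorm_ge0// mulr_ge0// ltW.
  rewrite -[gphi z](subrKC (gphi 0)); apply: le_trans (ler_enormD _ _) _.
  rewrite lerD2l; apply: le_trans (gphi_lip _ _) _.
  by rewrite subr0 ler_wpM2l// ltW.
by split; lra.
Qed.

Lemma initial_upper xh z0 w0 : exists K0 : R, forall C,
  (forall i, spectral_norm (C i) <= 1) -> L C xh z0 w0 <= K0.
Proof.
pose b := nc%:R * (enorm xh * enorm xh) + \sum_i `|dotv (d i) xh + e i| + enorm (Q *m z0).
have b0 : 0 <= b by rewrite !addr_ge0 ?mulr_ge0 ?enorm_ge0// sumr_ge0.
exists (f xh + (phi z0 + enorm w0 * b + rho / 2 * b ^+ 2)) => C C1.
rewrite /lagr lerD2l -!addrA lerD2l; set r := res C xh z0.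
have rb : enorm r <= b.
  apply: le_trans (ler_enormD _ _) _; rewrite lerD2r.
  apply: le_trans (enorm_le_sum _) _.
  have -> : nc%:R * (enorm xh * enorm xh) = \sum_(i < nc) enorm xh * enorm xh.
    by rewrite sumr_const card_ord -[RHS]mulr_natl.
  rewrite -big_split/=; apply: ler_sum => i _; rewrite mxE -addrA.
  apply: le_trans (ler_normD _ _) _; rewrite lerD2r normrM ger0_norm ?invr_ge0//.
  rewrite ler_pdivrMl//; have := quad_form_le xh xh (C1 i).
  have := mulr_ge0 (enorm_ge0 xh) (enorm_ge0 xh); lra.
apply: lerD.
  by apply: le_trans (dotv_le _ _) _; rewrite ler_wpM2l ?enorm_ge0.
by rewrite ler_wpM2l ?divr_ge0 ?(ltW rho_gt0)// ler_pXn2r ?nnegrE ?enorm_ge0.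
Qed.

(** The initial [z] and [w] need not satisfy the optimality relation behind [step_descent], so the
    rise [rho |r|^2] of the first dual update is bounded by the Lagrangian value itself. *)
Lemma first_iterate_upper K0 w0 : exists K1 : R, forall C x z w,
  L C x z w0 <= K0 -> w = w0 + rho *: res C x z -> L C x z w <= K1.
Proof.
pose cf := f 0 - enorm (gf 0) ^+ 2 / mu_f; pose cp := phi 0 - enorm (gphi 0) ^+ 2 / mu_phi.
exists (K0 + 4 * (K0 - cf - cp + enorm w0 ^+ 2 / rho)) => C x z w LK ->.
set r := res C x z.
have -> : L C x z (w0 + rho *: r) = L C x z w0 + rho * enorm r ^+ 2.
  by rewrite /lagr -/r dotvDl dotvZl -enorm_sqr; ring.
have := quad_growth x mu_f_gt0 f_conv; have := quad_growth z mu_phi_gt0 phi_conv.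
have := mulr_ge0 (divr_ge0 (ltW mu_f_gt0) (ler0n R 4)) (sqr_ge0 (enorm x)).
have := mulr_ge0 (divr_ge0 (ltW mu_phi_gt0) (ler0n R 4)) (sqr_ge0 (enorm z)).
rewrite -/cf -/cp; move: LK; rewrite /lagr -/r.
have := dotv_geN w0 r.
have : 0 <= (rho / 2 * enorm r - enorm w0) ^+ 2 / rho.
  by rewrite divr_ge0 ?sqr_ge0// ltW.
have -> : (rho / 2 * enorm r - enorm w0) ^+ 2 / rho =
    rho / 4 * enorm r ^+ 2 - enorm w0 * enorm r + enorm w0 ^+ 2 / rho.
  by field; rewrite gt_eqF.
lra.
Qed.

End Bounds.

(** * The constrained problem *)

Section Polyhedra.
Variable R : realType.

Lemma polyhedral_convex p (S : set 'cV[R]_p) x y (t : R) : polyhedral S ->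
  S x -> S y -> 0 <= t <= 1 -> S (x + t *: (y - x)).
Proof.
move=> [m [a [b [_ ->]]]] /= Sx Sy /andP[t0 t1] j _ /=.
have /= hx := Sx j I; have /= hy := Sy j I.
rewrite dotvDr dotvZr dotvBr; nra.
Qed.

Lemma polyhedral_closed p (S : set 'cV[R]_p) : polyhedral S -> closed S.
Proof.
move=> [m [a [b [_ ->]]]]; apply: closed_bigI => j _.
apply: (@preimage_closed _ _ (dotv (a j)) [set r | r <= b j]).
  by move=> x _; exact: continuous_dotv.
exact: closed_le.
Qed.

Lemma closed_vanishing p (S : set 'cV[R]_p) (u : nat -> 'cV[R]_p) l : closed S ->
  (forall k, S (u k)) -> vanishing (fun k => enorm (u k - l)) -> S l.
Proof.
move=> cS Su /cvg_enorm ul; apply: (closed_cvg S cS _ _ ul).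
by apply: nearW => k; exact: Su.
Qed.

End Polyhedra.

Section Problem.
Variables (R : realType) (n : nat) (dim : 'I_n -> nat) (nz nc : nat).
Local Notation nx := (\sum_(i < n) dim i)%N.
Variables (f : 'cV[R]_nx -> R) (X : forall i : 'I_n, set 'cV[R]_(dim i)).
Variables (phi : 'cV[R]_nz -> R) (Q : 'M[R]_(nc, nz)) (rho : R).
Variables (C : 'I_nc -> 'M[R]_nx) (d : 'I_nc -> 'cV[R]_nx) (e : 'I_nc -> R).
Arguments X : clear implicits.
Local Notation A := (quad_op C d e).
Local Notation L := (lagr f phi Q rho C d e).
Local Notation EL := (lagrangian (objF f X) phi A Q rho).

Definition feasible : set 'cV[R]_nx := [set x | forall i, X i (submxcol x i)].

Lemma objFE x : objF f X x = if `[< feasible x >] then (f x)%:E else +oo%E.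
Proof.
rewrite /objF; case: asboolP => [Xx|nXx].
  rewrite [X in (_ + X)%E]big1 ?adde0// => i _.
  by rewrite /indicator; case: asboolP => // /(_ (Xx i)).
have [i Xi] : exists i, ~ X i (submxcol x i) by apply/existsNP.
rewrite [X in (_ + X)%E](_ : _ = +oo%E)//; apply/esum_eqyP.
  by move=> j _; rewrite /indicator; case: ifP.
by exists i; split=> //; rewrite /indicator; case: asboolP.
Qed.

Lemma lagrangianE x z w :
  EL x z w = if `[< feasible x >] then (L x z w)%:E else +oo%E.
Proof. by rewrite /lagrangian objFE; case: ifP => //= _; rewrite EFinD. Qed.

Lemma lagrangian_feasible x z w : feasible x -> EL x z w = (L x z w)%:E.
Proof. by move=> Xx; rewrite lagrangianE; case: asboolP. Qed.

Lemma lagrangian_lty x z w : (EL x z w < +oo)%E -> feasible x.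
Proof. by rewrite lagrangianE; case: asboolP => // _; rewrite ltxx. Qed.

Lemma set_block_sweep (x x' : 'cV[R]_nx) (i : 'I_n) :
  set_block (sweep x x' i) i (submxcol x' i) = sweep x x' i.+1.
Proof.
rewrite set_blockE sweepS; congr (_ + _); apply/mxcolP => j.
have [<-|ij] := eqVneq i j; last by rewrite !submxcol_blk_neq.
by rewrite !submxcol_blk !submxcolB submxcol_sweep ltnn.
Qed.

(** Turns a competitor of the block minimization into a displacement of the updated point, the form
    used in [is_step]. *)
Lemma set_block_sweepD (x x' y : 'cV[R]_nx) (i : 'I_n) :
  set_block (sweep x x' i) i (submxcol y i) = sweep x x' i.+1 + blk i (y - x').
Proof.
rewrite set_blockE sweepS -[RHS]addrA -blkD; congr (_ + _); apply/mxcolP => j.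
have [<-|ij] := eqVneq i j; last by rewrite !submxcol_blk_neq.
rewrite !submxcol_blk [LHS]submxcolB submxcol_sweep ltnn submxcolD !submxcolB.
by rewrite [RHS]addrC addrA subrK.
Qed.

Lemma feasible_set_block (x x' y : 'cV[R]_nx) (i : 'I_n) : feasible (sweep x x' i.+1) ->
  X i (submxcol y i) -> feasible (set_block (sweep x x' i) i (submxcol y i)).
Proof.
move=> Xs Xy j; have [<-|ij] := eqVneq i j; first by rewrite submxcol_set_block.
rewrite submxcol_set_block_neq//; have := Xs j; rewrite !submxcol_sweep ltnS.
by move: ij; rewrite leq_eqVlt eq_sym -val_eqE => /negbTE ->.
Qed.

Lemma feasible_convex x y (t : R) : (forall i, polyhedral (X i)) ->
  feasible x -> feasible y -> 0 <= t <= 1 -> feasible (x + t *: (y - x)).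
Proof.
move=> pX Xx Xy t01 i; rewrite submxcolD submxcolZ submxcolB.
exact: polyhedral_convex.
Qed.

Lemma continuous_submxcol i : continuous (fun x : 'cV[R]_nx => submxcol x i).
Proof.
move=> x A /nbhs_ballP[eps /= e0 hA]; apply/nbhs_ballP; exists eps => // y [_ h].
by apply: hA; split=> // j k; rewrite !mxE; exact: h.
Qed.

Lemma feasible_closed : (forall i, polyhedral (X i)) -> closed feasible.
Proof.
move=> pX; rewrite (_ : feasible = \bigcap_(i in setT) [set x | X i (submxcol x i)]).
  apply: closed_bigI => i _.
  apply: (@preimage_closed _ _ (fun x : 'cV[R]_nx => submxcol x i) (X i)).
    by move=> x _; exact: continuous_submxcol.
  exact: polyhedral_closed.
by apply/seteqP; split=> x /= h i => [_|]; exact: h.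
Qed.

(** * ADMM iterates as sweeps *)

Section Iterates.
Variables (x : nat -> 'cV[R]_nx) (z : nat -> 'cV[R]_nz) (w : nat -> 'cV[R]_nc).
Variables (x0 : 'cV[R]_nx) (z0 : 'cV[R]_nz) (w0 : 'cV[R]_nc).
Hypothesis admm : ADMM_iterates EL A Q rho x0 z0 w0 x z w.

(** A minimizer has a finite value, so every sweep point is feasible and the comparison takes place
    between reals. *)
Lemma iterates_sweep k (i : 'I_n) : feasible (sweep (x k) (x k.+1) i.+1) /\
  forall y, X i (submxcol y i) ->
    L (sweep (x k) (x k.+1) i.+1) (z k) (w k) <=
    L (sweep (x k) (x k.+1) i.+1 + blk i (y - x k.+1)) (z k) (w k).
Proof.
case: admm => _ _ _ /(_ k)[/(_ i)[hlt hmin] _ _].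
rewrite partial_updateE set_block_sweep in hlt hmin.
have Xs := lagrangian_lty hlt; split=> // y Xy.
have := hmin (submxcol y i).
rewrite lagrangian_feasible// lagrangian_feasible; last exact: feasible_set_block.
by rewrite lee_fin set_block_sweepD.
Qed.

Lemma iterates_feasible k : feasible (x k.+1).
Proof.
move=> i; have [/(_ i) + _] := iterates_sweep k i.
by rewrite submxcol_sweep ltnSn.
Qed.

Lemma iterates_z_min k v : L (x k.+1) (z k.+1) (w k) <= L (x k.+1) v (w k).
Proof.
case: admm => _ _ _ /(_ k)[_ [_ /(_ v) hv] _].
have Xx := iterates_feasible k.
by move: hv; rewrite !lagrangian_feasible// lee_fin.
Qed.

(* The first block of [x0] may be infeasible; it has no influence on the first
   iterate, and [xh] is [x0] with this block replaced by a feasible one. *)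
Lemma iterates_first_le xh : x 0%N = x0 ->
  (forall j : 'I_n, (0 < j)%N -> submxcol xh j = submxcol x0 j) ->
  feasible xh -> L (x 1%N) (z 0%N) (w 0%N) <= L xh (z 0%N) (w 0%N).
Proof.
move=> xE xhE Xxh.
have h (i : 'I_n) : L (sweep xh (x 1%N) i.+1) (z 0%N) (w 0%N) <=
    L (sweep xh (x 1%N) i) (z 0%N) (w 0%N).
  have [_ /(_ xh (Xxh i))] := iterates_sweep 0 i.
  rewrite -set_block_sweepD xE.
  have -> : sweep x0 (x 1%N) i.+1 = sweep xh (x 1%N) i.+1.
    apply/mxcolP => j; rewrite !submxcol_sweep; case: ltnP => // ij.
    by rewrite xhE// (leq_ltn_trans _ ij).
  rewrite (_ : set_block _ _ _ = sweep xh (x 1%N) i)//; apply/mxcolP => j.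
  have [<-|ij] := eqVneq i j.
    by rewrite submxcol_set_block submxcol_sweep ltnn.
  rewrite submxcol_set_block_neq// !submxcol_sweep; case: ltnP => // ji.
  rewrite xhE// (leq_ltn_trans (leq0n i))// ltn_neqAle ji andbT.
  by apply: contra ij => /eqP ?; apply/eqP/val_inj.
have : forall m, (m <= n)%N -> L (sweep xh (x 1%N) m) (z 0%N) (w 0%N) <=
    L xh (z 0%N) (w 0%N).
  elim=> [|m ih] mn; first by rewrite sweep0.
  by apply: le_trans (ih (ltnW mn)); exact: h (Ordinal mn).
by move=> /(_ n (leqnn n)); rewrite sweep_full.
Qed.

End Iterates.

(** With [G] the gradient in [z], minimality along [g = - G] gives [- |G|^2 >= 0]. *)
Lemma z_stationary x z w (gphi : 'cV[R]_nz -> 'cV[R]_nz) Lphi mu_phi :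
  0 < mu_phi -> 0 <= Lphi ->
  (forall x y, phi x + dotv (gphi x) (y - x) + mu_phi / 2 * enorm (y - x) ^+ 2 <= phi y) ->
  (forall x y, enorm (gphi x - gphi y) <= Lphi * enorm (x - y)) ->
  (forall v, L x z w <= L x v w) ->
  gphi z = - (Q^T *m (w + rho *: residual Q C d e x z)).
Proof.
move=> mu0 Lphi0 phi_conv gphi_lip hmin; set r := residual _ _ _ _ _ _.
apply/eqP; rewrite -addr_eq0; set G := _ + _.
rewrite -dotv_eq0 eq_le dotv_ge0 andbT -oppr_ge0 -dotvNr; set g := - G.
apply: (@ge0_of_quad _ _ (Lphi * enorm g ^+ 2 + rho / 2 * enorm (Q *m g) ^+ 2)).
move=> t /andP[t0 t1].
have := hmin (z + t *: g); rewrite /lagr.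
have -> : residual Q C d e x (z + t *: g) = r + t *: (Q *m g).
  by rewrite /r /residual mulmxDr addrA scalemxAr.
rewrite -/r => h1.
have h2 := aug_sqr rho w r (t *: (Q *m g)).
rewrite dotvZr enormZ exprMn real_normK ?num_real// in h2.
have h3 := phi_conv (z + t *: g) z.
rewrite opprD addNKr enormN dotvNr dotvZr in h3.
have h4 := dotv_le (gphi (z + t *: g) - gphi z) (t *: g).
rewrite dotvBl !dotvZr in h4.
have h5 := ler_wpM2r (enorm_ge0 (t *: g)) (gphi_lip (z + t *: g) z).
rewrite addrAC subrr add0r enormZ ger0_norm// in h5 h4.
have h6 : dotv G g = dotv (gphi z) g + dotv (w + rho *: r) (Q *m g).
  by rewrite (dotv_mulmxr Q) -dotvDl.
have h7 := mulr_ge0 (divr_ge0 (ltW mu0) (ler0n R 2)) (sqr_ge0 (enorm (t *: g))).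
rewrite h6; lra.
Qed.

Lemma continuous_lagr w : continuous f -> continuous phi ->
  continuous (fun p : 'cV[R]_nx * 'cV[R]_nz => L p.1 p.2 w).
Proof.
move=> cf cphi.
have cst1 (g : 'cV[R]_nx -> R) : continuous g ->
    continuous (fun p : 'cV[R]_nx * 'cV[R]_nz => g p.1).
  by move=> cg p; apply: continuous_comp; [exact: cvg_fst|exact: cg].
have cst2 (g : 'cV[R]_nz -> R) : continuous g ->
    continuous (fun p : 'cV[R]_nx * 'cV[R]_nz => g p.2).
  by move=> cg p; apply: continuous_comp; [exact: cvg_snd|exact: cg].
have cr i : continuous (fun p : 'cV[R]_nx * 'cV[R]_nz => residual Q C d e p.1 p.2 i 0).
  rewrite (_ : (fun _ => _) = fun p => 2^-1 * dotv p.1 (C i *m p.1) +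
      dotv (d i) p.1 + e i + dotv (row i Q)^T p.2); last first.
    apply/funext => p; rewrite !mxE; congr (_ + _).
    by apply: eq_bigr => j _; rewrite !mxE.
  apply: continuous_addr; last exact: cst2 _ (@continuous_dotv R _ _).
  apply: continuous_addr; last exact: cst_continuous.
  apply: continuous_addr; last exact: cst1 _ (@continuous_dotv R _ _).
  apply: continuous_mulr; first exact: cst_continuous.
  exact: cst1 _ (@continuous_quad R _ _).
rewrite /lagr; apply: (continuous_addr (cst1 _ cf)); apply: continuous_addr.
  apply: (continuous_addr (cst2 _ cphi)); apply: continuous_sumr => i.
  by apply: continuous_mulr; [exact: cst_continuous|exact: cr].
apply: continuous_mulr; first exact: cst_continuous.
rewrite (_ : (fun _ => _) = fun p : 'cV[R]_nx * 'cV[R]_nz =>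
    dotv (residual Q C d e p.1 p.2) (residual Q C d e p.1 p.2)).
  by apply: continuous_sumr => i; apply: continuous_mulr; exact: cr.
by apply/funext => p; rewrite enorm_sqr.
Qed.

Lemma eball_min p r w : continuous f -> continuous phi ->
  (forall i, polyhedral (X i)) -> 0 <= r ->
  exists v, is_min (eball p r) (fun q => EL q.1 q.2 w) v.
Proof.
move=> cf cphi pX r0.
have pball : eball p r p by rewrite /eball /= !subrr !enorm0 expr0n/= addr0 sqrtr0.
pose S := eball p r `&` [set q | feasible q.1].
(* A ball around an infeasible initial point may miss the feasible set; the minimum is then
   [+oo]. *)
have [S0|/set0P SS] := eqVneq S set0.
  have hy q : eball p r q -> EL q.1 q.2 w = +oo%E.
    move=> qr; rewrite lagrangianE; case: asboolP => // Xq.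
    by have : S q by []; rewrite S0.
  by exists +oo%E; split=> [|q /hy ->//]; exists p => //; exact: hy.
have closS : closed S.
  apply: closedI.
    have cn : continuous (fun q : 'cV[R]_nx * 'cV[R]_nz =>
        Num.sqrt (enorm (q.1 - p.1) ^+ 2 + enorm (q.2 - p.2) ^+ 2)).
      move=> q; apply: (@continuous_comp _ _ _ (fun q : 'cV[R]_nx * 'cV[R]_nz =>
        enorm (q.1 - p.1) ^+ 2 + enorm (q.2 - p.2) ^+ 2)); last exact: sqrt_continuous.
      have h1 : continuous (fun q : 'cV[R]_nx * 'cV[R]_nz => enorm (q.1 - p.1)).
        move=> t; apply: (@continuous_comp _ _ _ (@fst 'cV[R]_nx 'cV[R]_nz)
          (fun x : 'cV[R]_nx => enorm (x - p.1))).
          exact: cvg_fst.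
        exact: continuous_enormB.
      have h2 : continuous (fun q : 'cV[R]_nx * 'cV[R]_nz => enorm (q.2 - p.2)).
        move=> t; apply: (@continuous_comp _ _ _ (@snd 'cV[R]_nx 'cV[R]_nz)
          (fun x : 'cV[R]_nz => enorm (x - p.2))).
          exact: cvg_snd.
        exact: continuous_enormB.
      exact: (continuous_addr (continuous_mulr h1 h1) (continuous_mulr h2 h2)).
    apply: (@preimage_closed _ _ _ [set s | s <= r]) => [q _|]; first exact: cn.
    exact: closed_le.
  apply: (@preimage_closed _ _ (@fst 'cV[R]_nx 'cV[R]_nz) feasible) => [q _|].
    exact: cvg_fst.
  exact: feasible_closed.
have Sb q : S q -> enorm q.1 <= enorm p.1 + enorm p.2 + r /\
    enorm q.2 <= enorm p.1 + enorm p.2 + r.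
  move=> [qr _]; have h1 : enorm (q.1 - p.1) <= r.
    apply: le_trans qr; rewrite -[leLHS]ger0_norm ?enorm_ge0// -sqrtr_sqr.
    by rewrite ler_sqrt ?addr_ge0 ?sqr_ge0// lerDl sqr_ge0.
  have h2 : enorm (q.2 - p.2) <= r.
    apply: le_trans qr; rewrite -[leLHS]ger0_norm ?enorm_ge0// -sqrtr_sqr.
    by rewrite ler_sqrt ?addr_ge0 ?sqr_ge0// lerDr sqr_ge0.
  have := ler_enormD p.1 (q.1 - p.1); have := ler_enormD p.2 (q.2 - p.2).
  rewrite !subrKC; have := enorm_ge0 p.1; have := enorm_ge0 p.2; split; lra.
have [c [cr Xc] hc] := compact_pair_min (@continuous_lagr w cf cphi) closS SS Sb.
exists (L c.1 c.2 w)%:E; split.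
  by exists c => //; rewrite lagrangian_feasible.
move=> q qr; rewrite lagrangianE; case: asboolP => [Xq|_]; last exact: leey.
by rewrite lee_fin; apply: hc.
Qed.

End Problem.

(** * Choice of the constants, rate and local minimality *)

Unset Implicit Arguments.
Set Strict Implicit.
Set Printing Implicit Defensive.

Theorem theorem3p3 (R : realType) (n : nat) (dim : 'I_n -> nat) (nz nc : nat)
  (f : 'cV[R]_(\sum_(i < n) dim i) -> R) (mu_f : R)
  (X : forall i : 'I_n, set 'cV[R]_(dim i))
  (phi : 'cV[R]_nz -> R) (mu_phi L_phi : R)
  (Q : 'M[R]_(nc, nz))
  (d : 'I_nc -> 'cV[R]_(\sum_(i < n) dim i)) (e : 'I_nc -> R)
  (rho : R)
  (x0 : 'cV[R]_(\sum_(i < n) dim i)) (z0 : 'cV[R]_nz) (w0 : 'cV[R]_nc)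
  (nc_gt0 : (0 < nc)%N)
  (F_subanalytic : subanalytic_fun (objF f X))
  (f_C2 : C2 f) (f_convex : strongly_convex mu_f f)
  (X_polyhedral : forall i, polyhedral (X i))
  (X_nonempty : forall i, X i !=set0)
  (phi_C2 : C2 phi) (phi_convex : strongly_convex mu_phi phi)
  (phi_smooth : L_smooth L_phi phi)
  (Q_full_row_rank : row_free Q)
  (rho_gt0 : 0 < rho)
  (rho_ge : Num.max
     (4 * L_phi ^+ 2 / (mu_phi * lambda_min_pos (Q^T *m Q)))
     (4 * L_phi ^+ 2 / (mu_phi * Num.sqrt (lambda_min_pos (Q *m Q^T)))) <= rho) :
  exists m1 m2 m3 : R, [/\ 0 < m1, 0 < m2, 0 < m3 &
  forall (C : 'I_nc -> 'M[R]_(\sum_(i < n) dim i))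
    (x : nat -> 'cV[R]_(\sum_(i < n) dim i))
    (z : nat -> 'cV[R]_nz) (w : nat -> 'cV[R]_nc),
  let A := quad_op C d e in
  let L := lagrangian (objF f X) phi A Q rho in
  let Qn := spectral_norm (invmx (Q *m Q^T) *m Q) in
  let lam := lambda_min (Q *m Q^T) in
  multi_affine A ->
  ADMM_iterates L A Q rho x0 z0 w0 x z w ->
  \big[Num.max/0]_(i < nc) spectral_norm (C i) <=
    Qn^-1 * Num.min m1 (Num.min (m2 * lam `^ 2^-1)
                                (m3 * lam `^ 4^-1 * Qn `^ 2^-1)) ->
  (exists c2 r : R, [/\ 1 < c2, 0 < r &
     exists v : nat -> \bar R,
       (forall k, is_min (eball (x k, z k) r)
                         (fun p => L p.1 p.2 (w k)) (v k)) /\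
       exists M : R, \forall k \near \oo,
         (`| L (x k) (z k) (w k) - v k | <= (M * c2 ^- k)%:E)%E]) /\
  (exists (xs : 'cV[R]_(\sum_(i < n) dim i)) (zs : 'cV[R]_nz),
     (fun k => (x k, z k)) @ \oo --> (xs, zs) /\
     is_local_min [set p | A p.1 + Q *m p.2 = 0]
                  (fun p => objF f X p.1 + (phi p.2)%:E)%E (xs, zs))].

Proof.
have mu_f0 : 0 < mu_f by case: f_convex.
have mu_phi0 : 0 < mu_phi by case: phi_convex.
have df : forall x, differentiable f x by case: f_C2 => [[]].
have dphi : forall x, differentiable phi x by case: phi_smooth.
have f_conv x y := strongly_convex_gradient y f_convex (df x).
have phi_conv x y := strongly_convex_gradient y phi_convex (dphi x).
have gf_lip B := C2_gradient_lipschitz B f_C2.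
have [_ gphi_lip] := phi_smooth.
have cf : continuous f by move=> x; exact: differentiable_continuous (df x).
have cphi : continuous phi by move=> x; exact: differentiable_continuous (dphi x).
have [lam0 lamP] := lambda_min_posP nc_gt0 Q_full_row_rank.
set lam := lambda_min_pos (Q^T *m Q) in lam0 lamP rho_ge.
have rho_ge' : 4 * L_phi ^+ 2 <= rho * mu_phi * lam.
  move: rho_ge; rewrite ge_max => /andP[+ _]; rewrite ler_pdivrMr ?mulr_gt0// => h.
  by apply: le_trans h _; rewrite mulrA.
have Lphi0 : 0 <= L_phi.
  exact: le_trans (ltW mu_phi0) (mu_le_lip nc_gt0 lam0 phi_conv gphi_lip lamP).
pose p j := projT1 (cid (X_nonempty j)).
have pX j : X j (p j) := projT2 (cid (X_nonempty j)).
pose xh : 'cV[R]_(\sum_(i < n) dim i) :=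
  \mxcol_j (if (j == 0 :> nat) then p j else submxcol x0 j).
(* Constants independent of [C]: [K0] bounds the initial value, [K1] the value after one iteration,
   and [B] all later iterates. *)
have [K0 hK0] := initial_upper f phi Q d e rho_gt0 xh z0 w0.
have [K1 hK1] := first_iterate_upper Q d e mu_f0 mu_phi0 rho_gt0 f_conv phi_conv K0 w0.
have [B B0 hB] := sublevel_bounded d e nc_gt0 mu_f0 mu_phi0 lam0 rho_gt0 f_conv
  phi_conv gphi_lip lamP rho_ge' K1.
(* The bound 1 serves [initial_upper], the other one [step_key]. *)
pose ep := Num.min 1 (mu_f / 2 / (nc%:R * (3 * B) + 1)).
have nB : 0 < nc%:R * (3 * B) + 1 by rewrite ltr_wpDl// !mulr_ge0.
have ep0 : 0 < ep by rewrite lt_min ltr01 !divr_gt0.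
have ep_small : nc%:R * ep * (3 * B) <= mu_f / 2.
  have : ep * (nc%:R * (3 * B) + 1) <= mu_f / 2.
    by rewrite -ler_pdivlMr// /ep ge_min lexx orbT.
  lra.
set Qn := spectral_norm (invmx (Q *m Q^T) *m Q).
have Qn0 : 0 <= Qn := spectral_norm_ge0 _.
(* [Qn] is positive, but with [0^-1 = 0] the case [Qn = 0] costs nothing. *)
exists (if Qn == 0 then 1 else ep * Qn), 1, 1; split=> //.
  by case: eqVneq => // Qn_neq0; rewrite mulr_gt0// lt_neqAle eq_sym Qn_neq0.
move=> C x z w A L Qn' lam' A_affine admm C_small.
have C_le i : spectral_norm (C i) <= ep.
  apply: le_trans (le_bigmax _ (fun i => spectral_norm (C i)) i) _.
  apply: le_trans C_small _.
  apply: (@le_trans _ _ (Qn^-1 * (if Qn == 0 then 1 else ep * Qn))).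
    by rewrite ler_wpM2l ?invr_ge0// ge_min lexx.
  case: eqVneq => [->|Qn_neq0]; first by rewrite invr0 mul0r ltW.
  by rewrite mulrCA mulVf// mulr1.
have C_le1 i : spectral_norm (C i) <= 1.
  by apply: le_trans (C_le i) _; rewrite /ep ge_min lexx.
have [x0E z0E w0E admm_k] := admm.
have feas k := iterates_feasible admm k.
have wE k : w k.+1 = w k + rho *: residual Q C d e (x k.+1) (z k.+1).
  by case: (admm_k k).
have gphi_w k : gradient phi (z k.+1) = - (Q^T *m w k.+1).
  rewrite wE; apply: (z_stationary mu_phi0 Lphi0 phi_conv gphi_lip).
  exact: iterates_z_min admm k.
(* The blocks of [x0] after the first one are still present when block 0 has been updated, and that
   sweep point is feasible. *)
have Xh : feasible X xh.
  move=> j; rewrite mxcolK; case: eqP => [_|/eqP j0]; first exact: pX.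
  pose i0 := Ordinal (leq_ltn_trans (leq0n j) (ltn_ord j)).
  have [/(_ j) + _] := iterates_sweep admm 0 i0.
  by rewrite submxcol_sweep ltnS leqn0 (negbTE j0) x0E.
(* The sequence starts at iterate 1, where feasibility and the relation between [z] and [w] are
   available. *)
have steps k : is_step f phi (gradient phi) Q rho C d e (feasible X)
    (x k.+1) (z k.+1) (w k.+1) (x k.+2) (z k.+2) (w k.+2).
  split=> //.
  by move=> i y Xy; case: (iterates_sweep admm k.+1 i) => _; apply.
have Xconv y y' t : feasible X y -> feasible X y' -> 0 <= t <= 1 ->
  feasible X (y + t *: (y' - y)) := feasible_convex X_polyhedral.
have Lk k : lagr f phi Q rho C d e (x k.+1) (z k.+1) (w k.+1) <= K1.
  elim: k => [|k ih].
    apply: hK1; last by rewrite wE w0E.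
    rewrite -w0E.
    apply: le_trans (iterates_z_min admm 0 (z 0%N)) _.
    apply: le_trans (hK0 C C_le1); rewrite -z0E -w0E.
    apply: iterates_first_le admm _ x0E _ Xh => j j0.
    by rewrite mxcolK gtn_eqF.
  apply: le_trans ih.
  have := step_descent mu_f0 lam0 rho_gt0 f_conv gf_lip phi_conv gphi_lip lamP
    rho_ge' A_affine Xconv (steps k) (gphi_w k).
  have := mulr_ge0 (divr_ge0 (ltW mu_f0) (ler0n R 2)) (sqr_ge0 (enorm (x k.+2 - x k.+1))).
  have := mulr_ge0 (divr_ge0 (ltW mu_phi0) (ler0n R 4)) (sqr_ge0 (enorm (z k.+2 - z k.+1))).
  lra.
have bnd k := hB C _ _ _ (gphi_w k) (Lk k).
have Xclosed := closed_vanishing (feasible_closed X_polyhedral).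
have [xl [zl [q [M [vx vz [q0 q1 M0] rate [Xxl rl gmin]]]]]] :=
  admm_convergence mu_f0 mu_phi0 lam0 rho_gt0 f_conv gf_lip phi_conv gphi_lip lamP
    rho_ge' A_affine Xconv B0 (ltW ep0) C_le ep_small Xclosed steps (gphi_w 0%N)
    (fun k => let: And3 h _ _ := bnd k in h) (fun k => let: And3 _ h _ := bnd k in h)
    (fun k => let: And3 _ _ h := bnd k in h).
split.
  exists q^-1, 1; split=> //; first by rewrite invf_gt1.
  have /choice[v hv] k := eball_min Q rho C d e (x k, z k) (w k) cf cphi X_polyhedral ler01.
  (* The rate bounds iterate [k.+2] by [M * q ^+ k]; dividing by [q ^+ 2] makes up for the shift. *)
  exists v; split=> //; exists (M / q ^+ 2); exists 2%N => // -[//|[//|k]] _ /=.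
  have [[[y t] _ /= vE] /(_ (x k.+2, z k.+2))/=] := hv k.+2.
  have cin : eball (x k.+2, z k.+2) 1 (x k.+2, z k.+2).
    by rewrite /eball/= !subrr !enorm0 expr0n/= addr0 sqrtr0.
  have Lx : lagrangian (objF f X) phi A Q rho (x k.+2) (z k.+2) (w k.+2) =
      (lagr f phi Q rho C d e (x k.+2) (z k.+2) (w k.+2))%:E.
    exact: lagrangian_feasible (feas k.+1).
  move=> /(_ cin); rewrite /L -vE !Lx.
  (* The center of the ball has a finite value, so the minimizer is feasible. *)
  rewrite lagrangianE; case: asboolP => [Xy|_]; last by rewrite leye_eq.
  rewrite lee_fin -EFinB abse_EFin lee_fin => vle.
  rewrite ger0_norm ?subr_ge0// -(exprVn q^-1) invrK.
  have := rate k y t Xy.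
  have -> : M / q ^+ 2 * q ^+ k.+2 = M * q ^+ k.
    by rewrite -[k.+2]add2n exprD mulrA mulfVK// gt_eqF// exprn_gt0.
  lra.
exists xl, zl; split.
  have cS p' (u : nat -> 'cV[R]_p') l :
      vanishing (fun k => enorm (u k.+2 - l)) -> u @ \oo --> l.
    by move=> /cvg_enorm ul; rewrite -(cvg_shiftS u) -(cvg_shiftS (fun k => u k.+1)).
  exact: (cvg_pair (cS _ _ _ vx) (cS _ _ _ vz)).
split=> [|/=|].
- exact: rl.
- by rewrite objFE; case: asboolP => // _; rewrite -EFinD ltry.
(* The limit is even a global minimizer on the constraint set, so the inequality holds at every
   point. *)
- apply: (@filterE _ (nbhs (xl, zl)) _) => -[y t] /= yt; rewrite !objFE.
  case: asboolP => // _; case: asboolP => [Xy|_]; last by rewrite addye// leey.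
  by rewrite -!EFinD lee_fin; exact: gmin.
Qed.
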